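(* Let $p\ge 1$ be an integer. Let $q$ be a super-critical offspring distribution ($\mu>1$) that admits a moment of order $p$. Then, for every $a\ge 0$, every $n\in\mathbb{N}$ and every $\Lambda_n\in\mathscr{F}_n$, $$\lim_{m\to+\infty}\frac{\mathbb{E}\left[H_p(Z_{m+n})e^{-aZ_{m+n}/\mu^{m+n}}\mathbf{1}_{\Lambda_n}\right]}{\mathbb{E}\left[H_p(Z_{m+n})e^{-aZ_{m+n}/\mu^{m+n}}\right]}=\mathbb{E}\left[\frac{1}{\mu^{pn}}G_n^{(p)}(Z_n)\mathbf{1}_{\Lambda_n}\right],$$ where $$G_n^{(p)}(x)=\frac{p!}{\phi^{(p)}(a)}\sum_{i=1}^p a_i^{(p)}(n)\,\phi(a/\mu^n)^{x-i}H_i(x),\qquad a_i^{(p)}(n)=\sum_{(n_1,\ldots,n_i)\in S_{i,p}}\ \prod_{r=1}^i\frac{\phi^{(n_r)}(a/\mu^n)}{n_r!}.$$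
   Context: $q=(q_n)_{n\in\mathbb{N}}$ is a probability distribution on the nonnegative integers with finite mean $\mu=\sum_n nq_n$. $(Z_n)_{n\ge 0}$ is the Galton-Watson process with offspring distribution $q$ started from $Z_0=1$, and $(\mathscr{F}_n)_{n\ge 0}$ is its natural filtration. $W$ is the a.s. limit of the nonnegative martingale $(Z_n/\mu^n)_{n\ge 0}$ and $\phi(a)=\mathbb{E}[e^{-aW}]$, $a\ge 0$, is its Laplace transform; $\phi^{(k)}$ is its $k$-th derivative (one-sided at $0$). $S_{i,p}=\{(n_1,\ldots,n_i)\in\{1,2,\dots\}^i:\ n_1+\cdots+n_i=p\}$. The polynomials $H_k$ are $H_0(x)=1$ and $H_k(x)=\frac{1}{k!}\prod_{j=0}^{k-1}(x-j)$ for $k\ge 1$.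
   Formalization: For p = 1 it is additionally assumed that φ'(a) ≠ 0: a finite mean alone allows W = 0 a.s. (when Σ n log n q_n = ∞), and then φ = 1 and G_n^{(1)}, which divides by φ'(a), is undefined. *)

(* Defs.v *)
From HB Require Import structures.
From mathcomp Require Export all_boot all_order all_algebra.
From mathcomp Require Export all_classical all_reals all_analysis.

Set Implicit Arguments.
Unset Strict Implicit.
Unset Printing Implicit Defensive.

Import Order.TTheory GRing.Theory Num.Theory.
Import numFieldNormedType.Exports.

Local Open Scope classical_set_scope.
Local Open Scope ring_scope.

Definition mutually_independent d d' (T : measurableType d)
    (T' : measurableType d') (R : realType) (P : probability T R)
    (I : choiceType) (X : I -> {RV P >-> T'}) : Prop :=
  forall (J : seq I) (B : I -> set T'), uniq J ->
    (forall i, measurable (B i)) ->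
    P (\bigcap_(i in [set` J]) (X i @^-1` B i)) =
    (\prod_(i <- J) P (X i @^-1` B i))%E.

Section Offspring.
Context {R : realType}.
Implicit Type q : nat -> R.

Definition moment q (p : nat) : \bar R :=
  (\sum_(0 <= k <oo) (k%:R ^+ p * q k)%:E)%E.

Definition mean q : R := fine (moment q 1).

Record offspring_distribution q : Prop := OffspringDistribution {
  offspring_ge0 : forall k, 0 <= q k ;
  offspring_sum1 : series q @ \oo --> (1 : R) ;
  offspring_mean_fin : (moment q 1 < +oo)%E }.

End Offspring.

Section GaltonWatson.
Context {d} {T : measurableType d} {R : realType} (P : probability T R).

(* [xi (n, k)] is the number of children of the k-th individual of
   generation n. *)
Definition galton_watson (q : nat -> R) (Z : nat -> {RV P >-> nat}) : Prop :=
  exists xi : nat * nat -> {RV P >-> nat},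
    [/\ mutually_independent xi,
        forall i j, P (xi i @^-1` [set j]) = (q j)%:E,
        forall w, Z 0%N w = 1%N &
        forall n w, Z n.+1 w = (\sum_(k < Z n w) xi (n, val k) w)%N].

Definition natural_filtration (Z : nat -> {RV P >-> nat}) (n : nat) :
    set (set T) :=
  g_sigma_preimage (fun k : 'I_n.+1 => Z k : T -> nat).

Definition laplace_transform (W : {RV P >-> R}) (a : R) : R :=
  fine 'E_P[fun w => expR (- (a * W w))].

End GaltonWatson.

Section HalfLineDerivative.
Context {R : realType}.
Implicit Type f : R -> R.

(* Derivative of a function on [0, +oo[, one-sided at 0; the values of [f] on
   the negative reals are never used. *)
Definition halfline_derive f (x : R) : R :=
  if 0 < x then derive1 f x else lim (h^-1 * (f (h + x) - f x) @[h --> 0^'+]).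

Definition halfline_deriven (k : nat) f : R -> R := iter k halfline_derive f.

End HalfLineDerivative.

Definition Hpoly (R : realType) (k : nat) : {poly R} :=
  (k`!%:R)^-1 *: \prod_(j < k) ('X - (j%:R)%:P).

(* Parts are bounded by p, whence the finite codomain. *)
Definition compositions (i p : nat) : {set {ffun 'I_i -> 'I_p.+1}} :=
  [set s : {ffun 'I_i -> 'I_p.+1} |
    [forall r, (0 < s r)%N] && ((\sum_(r < i) s r)%N == p)].

Definition acoef (R : realType) (phi : R -> R) (mu a : R) (p i n : nat) : R :=
  \sum_(s in compositions i p)
    \prod_(r < i) (halfline_deriven (s r) phi (a / mu ^+ n) / (s r)`!%:R).

(* The exponent x - i is an integer, possibly negative. *)
Definition Gfun (R : realType) (phi : R -> R) (mu a : R) (p n x : nat) : R :=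
  p`!%:R / halfline_deriven p phi a *
  \sum_(1 <= i < p.+1)
    acoef phi mu a p i n * (phi (a / mu ^+ n)) ^ (x%:Z - i%:Z)
      * (Hpoly R i).[x%:R].

(* Main.v *)
Require Import Defs.
From mathcomp Require Import ring lra measurable_realfun.

Set Implicit Arguments.
Unset Strict Implicit.
Unset Printing Implicit Defensive.

Import Order.TTheory GRing.Theory Num.Theory.
Import numFieldNormedType.Exports.

Local Open Scope classical_set_scope.
Local Open Scope ring_scope.

(** The idea is to work with Laplace transforms on events instead of
    conditional expectations. Let A be an event of the past of generation n on
    which Z_n = x. By independence of the offspring numbers (branching_pgf) the
    generating function of Z_(m+n) on A is P(A) times the x-th power of that of
    Z_m. Evaluating at exp (- a / mu^(m+n)) and letting m grow gives
    (laplace_fiber)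
<<
      E[exp (- a W) 1_A] = P(A) phi(a / mu^n)^x    for all a >= 0.
>>
    Both sides are p times differentiable on the half-line. On the left the
    derivatives are (- 1)^k E[W^k exp (- a W) 1_A]; on the right they are
    coefficients of the x-th power of the Taylor polynomial of phi, and the
    binomial theorem writes coefficient p as the sum over i of H_i(x),
    phi^(x-i) and a sum over compositions of p into i parts. Summing over x,
    the right-hand side of the theorem is therefore (expectation_Gfun)
<<
      E[W^p exp (- a W) 1_L] / E[W^p exp (- a W)].
>>
    It remains to pass to the limit in the numerator, after division by
    mu^(p(m+n)); the denominator is the case of the sure event. Almost surely
    Y_n = p! H_p(Z_n) / mu^(p n) tends to W^p. If a > 0 and p = 1 the weight
    exp (- a Z_n / mu^n) gives a dominating constant. If p >= 2, then
    E[Y_n] <= E[W^p] < oo, which by the argument of Scheffe's lemma yields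
    convergence in mean (scheffe_weighted). Here E[W^p] is finite by Fatou's
    lemma, since the moments of order p of Z_n / mu^n are bounded
    (integral_power_bound), and E[Y_n] <= E[W^p] follows from the formula above
    at a = 0, where the term i = p equals E[Y_n] E[W]^p, because E[W] >= 1
    (mean_limit_ge1). If p = 1 and a = 0 the martingale property makes the
    quotient constant in m (mean_proportional).

    Polynomials carry the derivatives of all orders at once: a jet is a
    function into polynomials whose coefficients are successive derivatives up
    to factorials. Jets are closed under products and determined by their
    coefficient of order 0 (jet_unique), so an identity between functions
    becomes an identity between polynomials (laplace_jet_power). The same
    principle, applied to the offspring variable at 0, gives the recursion for
    the moments of Z_n.

    As the limit variable may be negative on a null set, the proofs use a
    nonnegative version V of it. *)

(** * Coefficients of powers of a polynomial *)

Section PowerCoefficients.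
Variables (R : comNzRingType) (C : {poly R}).

Let D := drop_poly 1 C * 'X.

Lemma poly_split0 : C = (C`_0)%:P + D.
Proof.
apply/polyP => -[|k]; rewrite /D coefD coefC coefMX /= ?addr0 //.
by rewrite add0r coef_drop_poly addn1.
Qed.

(** The i-th power of C minus its constant term is divisible by X^i, so only
    i <= p contribute to coefficient p, and x enters through binomials and
    powers of the constant term alone. The factors H_i(x) and phi^(x - i) of
    the limit law come from here. *)
Lemma coef_exp_split p x :
  (C ^+ x)`_p = \sum_(i < p.+1)
    'C(x, i)%:R * C`_0 ^+ (x - i) * (drop_poly 1 C ^+ i)`_(p - i).
Proof.
pose F i := 'C(x, i)%:R * C`_0 ^+ (x - i) *
  (if (p < i)%N then 0 else (drop_poly 1 C ^+ i)`_(p - i)).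
transitivity (\sum_(i < x.+1) F i).
  rewrite [in LHS]poly_split0 exprDn coef_sum; apply: eq_bigr => i _.
  by rewrite coefMn -polyC_exp coefCM exprMn_comm ?coefMXn /F ?mulr_natl
     ?mulrnAl //; exact: mulrC.
transitivity (\sum_(i < (x + p).+1) F i).
  rewrite (big_ord_widen (x + p).+1) ?ltnS ?leq_addr // big_mkcond /=.
  apply: eq_bigr => i _; case: ltnP => // xi.
  by rewrite /F bin_small // !mul0r.
transitivity (\sum_(i < p.+1) F i); last first.
  by apply: eq_bigr => i _; rewrite /F ltnNge -ltnS ltn_ord.
rewrite [RHS](big_ord_widen (x + p).+1) ?ltnS ?leq_addl // [RHS]big_mkcond /=.
apply: eq_bigr => i _; case: ltnP => // xi.
by rewrite /F xi mulr0.
Qed.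

(** Once the constant term is removed, only positive parts contribute. *)
Lemma coef_exp_compositions p i : (size C <= p.+1)%N -> (i <= p)%N ->
  (drop_poly 1 C ^+ i)`_(p - i) =
  \sum_(s in compositions i p) \prod_(r < i) C`_(s r).
Proof.
move=> sC ip.
have -> : (drop_poly 1 C ^+ i)`_(p - i) = (D ^+ i)`_p.
  by rewrite /D exprMn_comm ?coefMXn ?ltnNge ?ip //; exact: mulrC.
have DE : D = \sum_(k < p.+1) (if k == 0%N :> nat then 0 else C`_k) *: 'X^k.
  rewrite -(poly_def p.+1 (fun k => if k == 0%N then 0 else C`_k)).
  apply/polyP => -[|k]; rewrite coef_poly coefMX //=.
  rewrite coef_drop_poly addn1; case: ltnP => // pk.
  by rewrite nth_default // (leq_trans sC).
rewrite -[in LHS](card_ord i) -prodr_const DE bigA_distr_bigA /= coef_sum.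
rewrite [RHS]big_mkcond /=; apply: eq_bigr => s _.
rewrite scaler_prod coefZ prodrXr coefXn inE eq_sym.
case: forallP => [s0|s0] /=; last first.
  have [r sr] : exists r, s r = 0 :> nat.
    apply: contrapT => h; apply: s0 => r; rewrite lt0n.
    by apply/eqP => sr; apply: h; exists r.
  by rewrite (bigD1 r) //= sr eqxx !mul0r.
case: eqP => _; rewrite ?mulr0 // mulr1.
by apply: eq_bigr => r _; have := s0 r; rewrite lt0n; case: eqP.
Qed.

End PowerCoefficients.

Lemma coef0_exp (R : comNzRingType) (C : {poly R}) n : (C ^+ n)`_0 = C`_0 ^+ n.
Proof. by rewrite -!horner_coef0 horner_exp. Qed.

Lemma coef1_exp (R : comNzRingType) (C : {poly R}) x :
  C`_0 = 1 -> (C ^+ x)`_1 = C`_1 *+ x.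
Proof.
move=> C0; elim: x => [|x IH]; first by rewrite expr0 coefC mulr0n.
rewrite exprS coefM !big_ord_recl big_ord0 addr0 /= subn0 subnn C0 IH.
by rewrite coef0_exp C0 expr1n mulr1 mul1r mulrSr.
Qed.

Lemma natr_ffactS (R : realType) x k :
  (x ^_ k.+1)%:R = (x ^_ k)%:R * (x%:R - k%:R) :> R.
Proof.
rewrite ffactnSr natrM; have [kx|xk] := leqP k x; first by rewrite natrB.
by rewrite ffact_small // !mul0r.
Qed.

Lemma horner_Hpoly (R : realType) k x : (Hpoly R k).[x%:R] = 'C(x, k)%:R.
Proof.
rewrite /Hpoly hornerZ horner_prod.
have -> : \prod_(j < k) ('X - (j%:R)%:P).[x%:R] = (x ^_ k)%:R :> R.
  under eq_bigr do rewrite hornerXsubC.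
  elim: k => [|k IH]; first by rewrite big_ord0.
  by rewrite big_ord_recr /= IH natr_ffactS.
by rewrite -bin_ffact natrM mulrCA mulVf ?mulr1 // pnatr_eq0 -lt0n fact_gt0.
Qed.

(** * Jets: Taylor coefficients as functions of the base point *)

Section Jets.
Context {R : realType}.
Implicit Types (f g : R -> R) (J K : R -> {poly R}).

(** The derivative is taken from the right at every point: this suffices to
    identify the coefficients of a jet, and it treats the endpoint 0 of the
    half-line like any other point. *)
Definition right_derivative f (a l : R) : Prop :=
  h^-1 * (f (h + a) - f a) @[h --> 0^'+] --> l.

Lemma right_derivative_unique f a l l' :
  right_derivative f a l -> right_derivative f a l' -> l = l'.
Proof. exact: cvg_unique. Qed.

Lemma eq_right_derivative f g a l : 0 <= a -> (forall x, 0 <= x -> f x = g x) ->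
  right_derivative f a l -> right_derivative g a l.
Proof.
move=> a0 fg; apply: cvg_trans; apply: near_eq_cvg; near=> h.
rewrite -!fg // addr_ge0 //.
Unshelve. all: by end_near. Qed.

Lemma right_derivative_cst (c a : R) : right_derivative (fun=> c) a 0.
Proof.
rewrite /right_derivative; under eq_fun do rewrite subrr mulr0.
exact: cvg_cst.
Qed.

Lemma right_derivativeD f g a l m : right_derivative f a l ->
  right_derivative g a m -> right_derivative (fun x => f x + g x) a (l + m).
Proof.
move=> fl gm; apply: cvg_trans (cvgD fl gm).
by apply: near_eq_cvg; near=> h; rewrite !fctE /=; ring.
Unshelve. all: by end_near. Qed.

Lemma right_derivative_sum n (F : 'I_n -> R -> R) (L : 'I_n -> R) a :
  (forall i, right_derivative (F i) a (L i)) ->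
  right_derivative (fun x => \sum_i F i x) a (\sum_i L i).
Proof.
elim: n F L => [|n IH] F L FL.
  rewrite big_ord0 (_ : (fun _ => _) = fun=> 0); first exact: right_derivative_cst.
  by apply/funext => x; rewrite big_ord0.
rewrite big_ord_recr /= (_ : (fun _ => _) = fun x =>
   \sum_(i < n) F (widen_ord (leqnSn n) i) x + F ord_max x).
  by apply: right_derivativeD => //; exact: IH.
by apply/funext => x; rewrite big_ord_recr.
Qed.

Lemma right_derivative_continuous f a l : right_derivative f a l ->
  f (h + a) @[h --> 0^'+] --> f a.
Proof.
move=> fl; have h0 : (h : R) @[h --> 0^'+] --> (0 : R).
  by apply: cvg_at_right_filter; exact: cvg_id.
have : h * (h^-1 * (f (h + a) - f a)) + f a @[h --> 0^'+] --> 0 * l + f a.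
  by apply: cvgD; [exact: cvgM|exact: cvg_cst].
rewrite mul0r add0r => /(cvg_trans _); apply; apply: near_eq_cvg; near=> h.
have hn0 : h != 0 by near: h; exact: nbhs_right_neq.
by rewrite /= mulVKf // subrK.
Unshelve. all: by end_near. Qed.

Lemma right_derivativeM f g a l m : right_derivative f a l ->
  right_derivative g a m ->
  right_derivative (fun x => f x * g x) a (l * g a + f a * m).
Proof.
move=> fl gm; have fc := right_derivative_continuous fl.
apply: cvg_trans (cvgD (cvgM fl (cvg_cst (g a))) (cvgM fc gm)).
by apply: near_eq_cvg; near=> h; rewrite !fctE /=; ring.
Unshelve. all: by end_near. Qed.

(** A function f on the half-line is represented by a polynomial whose
    coefficient k at a, for k <= p, is (-1)^k f^(k)(a) / k!. The alternating sign, visible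
    as the opposite of the formal derivative, makes all coefficients of a
    Laplace transform nonnegative. *)
Definition jet (p : nat) J : Prop := forall k, (k < p)%N -> forall a, 0 <= a ->
  right_derivative (fun x => (J x)`_k) a (- ((J a)^`())`_k).

Lemma jet_cst p (c : R) : jet p (fun=> c%:P).
Proof.
by move=> k kp a a0; rewrite derivC coef0 oppr0; exact: right_derivative_cst.
Qed.

(** The Leibniz rule of every order at once: it is the derivation property of
    the formal derivative. *)
Lemma jetM p J K : jet p J -> jet p K -> jet p (fun a => J a * K a).
Proof.
move=> JJ KK k kp a a0; rewrite derivM coefD !coefM opprD -!sumrN -big_split /=.
rewrite (_ : (fun _ => _) = fun x => \sum_(i < k.+1) (J x)`_i * (K x)`_(k - i)).
  apply: right_derivative_sum => i.
  rewrite -mulNr -mulrN; apply: right_derivativeM; [apply: JJ|apply: KK] => //.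
  - by rewrite (leq_ltn_trans _ kp) // -ltnS.
  - by rewrite (leq_ltn_trans _ kp) // leq_subr.
by apply/funext => x; rewrite coefM.
Qed.

Lemma jetX p J n : jet p J -> jet p (fun a => J a ^+ n).
Proof.
move=> JJ; elim: n => [|n IH].
  by under eq_fun do rewrite expr0; exact: jet_cst.
by under eq_fun do rewrite exprS; exact: jetM.
Qed.

(** Each coefficient is, up to a factor, the derivative of the previous one. *)
Lemma jet_unique p J K : jet p J -> jet p K ->
  (forall a, 0 <= a -> (J a)`_0 = (K a)`_0) ->
  forall k, (k <= p)%N -> forall a, 0 <= a -> (J a)`_k = (K a)`_k.
Proof.
move=> JJ KK JK; elim=> [//|k IH] kp a a0.
have JD := JJ k kp a a0; have KD := KK k kp a a0.
have := right_derivative_unique (eq_right_derivative a0 (IH (ltnW kp)) JD) KD.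
move=> /oppr_inj; rewrite !coef_deriv => /eqP.
by rewrite eqr_pMn2r // => /eqP.
Qed.

End Jets.

(** * Laplace transforms and their derivatives on the half-line *)

Lemma Rintegral_dominated_cvg d (T : measurableType d) (R : realType)
    (P : probability T R) (A : set T) (f_ : nat -> T -> R) (f g : T -> R) :
  measurable A -> (forall n, measurable_fun A (f_ n)) -> measurable_fun A f ->
  {ae P, forall w, A w -> f_ n w @[n --> \oo] --> f w} ->
  P.-integrable A (EFin \o g) ->
  (forall n w, A w -> `|f_ n w| <= g w) ->
  (\int[P]_(w in A) f_ n w) @[n --> \oo] --> \int[P]_(w in A) f w.
Proof.
move=> mA mf_ mf ff ig fg.
have [|||||h1 _ h3] := @dominated_convergence _ _ _ P A mA
    (fun n => EFin \o f_ n) (EFin \o f) (EFin \o g).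
- by move=> n; apply/measurable_EFinP.
- exact/measurable_EFinP.
- apply: filterS ff => w ffw Aw.
  by apply/fine_cvgP; split; [exact: nearW|exact: ffw].
- exact: ig.
- by apply: aeW => w n Aw /=; rewrite lee_fin fg.
apply: fine_cvg; rewrite fineK; first exact: h3.
exact: integrable_fin_num.
Qed.

Section ExponentialBounds.
Context {R : realType}.

Lemma expRN_le1 (x : R) : 0 <= x -> expR (- x) <= 1.
Proof. by move=> x0; rewrite -expR0 ler_expR oppr_le0. Qed.

Lemma expRN_lipschitz (x y : R) : 0 <= x -> 0 <= y ->
  `|expR (- y) - expR (- x)| <= `|y - x|.
Proof.
wlog xy : x y / x <= y => [H x0 y0|x0 y0].
  by case: (leP x y) => [|/ltW] xy; [|rewrite distrC (distrC y)]; exact: H.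
rewrite ler0_norm ?subr_le0 ?ler_expR ?lerN2 // ger0_norm ?subr_ge0 // opprB.
have -> : - y = - x + - (y - x) by ring.
rewrite expRD -[X in X - _]mulr1 -mulrBr.
have := expR_ge1Dx (- (y - x)) => h.
rewrite -[leRHS]mul1r ler_pM ?expR_ge0 ?expRN_le1 //.
  by rewrite subr_ge0 expRN_le1 // subr_ge0.
by rewrite lerBlDr -lerBlDl.
Qed.

Lemma expRN_difference_quotient (a v : R) :
  h^-1 * (expR (- ((h + a) * v)) - expR (- (a * v))) @[h --> 0^'] -->
  - v * expR (- (a * v)).
Proof.
have D : is_derive a 1 (fun t : R => expR (- (t * v))) (- v * expR (- (a * v))).
  by apply: is_derive_eq; rewrite /GRing.scale /=; ring.
have -> : - v * expR (- (a * v)) = derive1 (fun t : R => expR (- (t * v))) a.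
  by rewrite derive1E derive_val.
rewrite /derive1; have := @ex_derive _ _ _ _ _ _ _ D.
rewrite /derivable.
by under eq_fun do rewrite -[_ *: 1]/(_ * 1) mulr1.
Qed.

End ExponentialBounds.

Section Laplace.
Context d (T : measurableType d) (R : realType) (P : probability T R).
Variables (V : T -> R) (A : set T) (p : nat).
Hypotheses (mV : measurable_fun setT V) (V0 : forall w, 0 <= V w)
  (mA : measurable A) (Vp : P.-integrable A (fun w => (V w ^+ p)%:E)).

Definition laplace_moment k a : R :=
  \int[P]_(w in A) (V w ^+ k * expR (- (a * V w))).

Definition laplace_jet a : {poly R} :=
  \poly_(k < p.+1) (laplace_moment k a / k`!%:R).

Lemma measurable_laplace k a :
  measurable_fun A (fun w => V w ^+ k * expR (- (a * V w))).
Proof.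
apply: (measurable_funS measurableT) => //.
apply: measurable_funM; first exact: measurable_funX.
apply: measurableT_comp => //; apply: measurableT_comp => //.
exact: measurable_funM.
Qed.

Lemma laplace_integrand_ge0 k a w : 0 <= V w ^+ k * expR (- (a * V w)).
Proof. by rewrite mulr_ge0 ?exprn_ge0 ?expR_ge0. Qed.

Lemma integrable_power k : (k <= p)%N ->
  P.-integrable A (EFin \o (fun w => V w ^+ k)).
Proof.
move=> kp; apply: (@le_integrable _ _ _ _ _ mA _
   (EFin \o (fun w => 1 + V w ^+ p))).
- apply/measurable_EFinP; apply: (measurable_funS measurableT) => //.
  exact: measurable_funX.
- move=> w _ /=; rewrite lee_fin !ger0_norm ?addr_ge0 ?exprn_ge0 //.
  have [V1|/ltW V1] := leP (V w) 1.
    by rewrite (le_trans (exprn_ile1 _ _ _)) // lerDl exprn_ge0.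
  by rewrite (le_trans (ler_weXn2l V1 kp)) // lerDr.
- exact: (integrableD mA (finite_measure_integrable_cst P 1 mA) Vp).
Qed.

Lemma integrable_laplace k a : (k <= p)%N -> 0 <= a ->
  P.-integrable A (EFin \o (fun w => V w ^+ k * expR (- (a * V w)))).
Proof.
move=> kp a0; apply: le_integrable (integrable_power kp) => //.
  by apply/measurable_EFinP; exact: measurable_laplace.
move=> w _ /=; rewrite lee_fin !ger0_norm ?laplace_integrand_ge0 ?exprn_ge0 //.
by rewrite ler_piMr ?exprn_ge0 ?expRN_le1 // mulr_ge0.
Qed.

Lemma laplace_moment_ge0 k a : 0 <= laplace_moment k a.
Proof. by apply: Rintegral_ge0 => w _; exact: laplace_integrand_ge0. Qed.

(** Differentiation under the integral sign. As t |-> exp (- t) is 1-Lipschitz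
    on the half-line, the difference quotients are dominated by V^(k+1), which
    is integrable up to k + 1 = p; this holds at a = 0 as well. *)
Lemma laplace_moment_quotient k (a : R) (u : nat -> R) : (k < p)%N -> 0 <= a ->
  (forall n, u n != 0) -> (forall n, 0 <= u n + a) -> u n @[n --> \oo] --> 0 ->
  (u n)^-1 * (laplace_moment k (u n + a) - laplace_moment k a) @[n --> \oo] -->
  - laplace_moment k.+1 a.
Proof.
move=> kp a0 u0 ua ucvg.
pose D n w := (u n)^-1 * (V w ^+ k * expR (- ((u n + a) * V w))
  - V w ^+ k * expR (- (a * V w))).
have iL b : 0 <= b ->
    P.-integrable A (EFin \o (fun w => V w ^+ k * expR (- (b * V w)))).
  by move=> b0; exact: (integrable_laplace (ltnW kp)).
have -> : (fun n => (u n)^-1 *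
    (laplace_moment k (u n + a) - laplace_moment k a)) =
    (fun n => \int[P]_(w in A) D n w).
  apply/funext => n; rewrite /laplace_moment -RintegralB ?iL // RintegralZl //.
  by have := integrableB mA (iL _ (ua n)) (iL _ a0).
have -> : - laplace_moment k.+1 a =
    \int[P]_(w in A) (- 1 * (V w ^+ k.+1 * expR (- (a * V w)))).
  by rewrite RintegralZl ?mulN1r // (integrable_laplace kp).
apply: Rintegral_dominated_cvg (integrable_power kp) _ => //.
- move=> n; apply: measurable_funM => //; apply: measurable_funB.
    exact: measurable_laplace.
  exact: measurable_laplace.
- by apply: measurable_funM => //; exact: measurable_laplace.
- apply: aeW => w _; rewrite mulN1r exprS.
  have -> : - (V w * V w ^+ k * expR (- (a * V w))) =
      V w ^+ k * (- V w * expR (- (a * V w))) by ring.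
  rewrite /D; under eq_fun do rewrite -mulrBr mulrCA.
  apply: cvgM; first exact: cvg_cst.
  by have /cvgr_dnbhsP := @expRN_difference_quotient _ a (V w); apply; split.
- move=> n w _; rewrite /D -mulrBr normrM normfV.
  rewrite ler_pdivrMl ?normr_gt0 // normrM (ger0_norm (exprn_ge0 _ (V0 w))).
  rewrite exprS mulrA [leRHS]mulrC ler_wpM2l ?exprn_ge0 //.
  rewrite (le_trans (expRN_lipschitz _ _)) ?mulr_ge0 //.
  by rewrite -mulrBl addrK normrM (ger0_norm (V0 w)).
Qed.

Lemma laplace_moment_right_derivative k (a : R) : (k < p)%N -> 0 <= a ->
  right_derivative (laplace_moment k) a (- laplace_moment k.+1 a).
Proof.
move=> kp a0; apply/cvg_at_rightP => u [u0 ucvg].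
apply: laplace_moment_quotient => // n; first by rewrite gt_eqF.
by rewrite addr_ge0 // ltW.
Qed.

Lemma laplace_moment_derivative k (a : R) : (k < p)%N -> 0 < a ->
  h^-1 *: (laplace_moment k (h + a) - laplace_moment k a) @[h --> 0^'] -->
  - laplace_moment k.+1 a.
Proof.
move=> kp a0; apply/cvgr_dnbhsP => u [u0 ucvg].
(* u is above - a only eventually; v is a modification that always is. *)
pose v n := if 0 <= u n + a then u n else a.
have uv : \forall n \near \oo, u n = v n.
  have /cvgrPdist_lt /(_ a a0) := ucvg.
  apply: filterS => n; rewrite sub0r normrN /v ltr_norml => /andP[un _].
  by rewrite ifT // -lerBlDr sub0r ltW.
have v0 n : v n != 0 by rewrite /v; case: ifP => // _; rewrite gt_eqF.
have va n : 0 <= v n + a by rewrite /v; case: ifP => // _; rewrite addr_ge0 ?ltW.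
have vcvg : v n @[n --> \oo] --> 0.
  by apply: cvg_trans ucvg; exact: near_eq_cvg.
have := laplace_moment_quotient kp (ltW a0) v0 va vcvg.
apply: cvg_trans; apply: near_eq_cvg; apply: filterS uv => n <- //.
Qed.

Lemma jet_laplace : jet p laplace_jet.
Proof.
move=> k kp a a0; rewrite coef_deriv !coef_poly ltnS kp.
under eq_fun do rewrite coef_poly ltnS (ltnW kp).
have -> : - (laplace_moment k.+1 a / k.+1`!%:R *+ k.+1) =
    - laplace_moment k.+1 a * (k`!%:R)^-1 + laplace_moment k a * 0.
  rewrite mulr0 addr0 -mulr_natr factS natrM invfM mulNr; congr (- _).
  by rewrite -mulrA; congr (_ * _); rewrite mulrAC mulVf ?mul1r.
apply: (@right_derivativeM _ (laplace_moment k) (fun=> (k`!%:R)^-1));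
  first exact: laplace_moment_right_derivative.
exact: right_derivative_cst.
Qed.

Lemma halfline_derive_laplace (f : R -> R) k (a : R) : (k < p)%N -> 0 <= a ->
  (forall x, 0 <= x -> f x = (- 1) ^+ k * laplace_moment k x) ->
  halfline_derive f a = (- 1) ^+ k.+1 * laplace_moment k.+1 a.
Proof.
move=> kp a0 fE; rewrite exprS mulN1r mulNr -mulrN /halfline_derive.
case: ifPn => [a1|].
  apply: cvg_lim => //.
  have : (- 1) ^+ k * (h^-1 *: (laplace_moment k (h + a) - laplace_moment k a))
      @[h --> 0^'] --> (- 1) ^+ k * - laplace_moment k.+1 a.
    by apply: cvgM; [exact: cvg_cst|exact: laplace_moment_derivative].
  apply: cvg_trans; apply: near_eq_cvg; near=> h.
  rewrite !fE // ?ltW //.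
    by rewrite /GRing.scale /=; ring.
  have : `|h| < a.
    near: h; apply: dnbhs0_lt => //.
  by rewrite ltr_norml => /andP[]; lra.
rewrite -leNgt => a1; apply: cvg_lim => //.
have : (- 1) ^+ k * (h^-1 * (laplace_moment k (h + a) - laplace_moment k a))
    @[h --> 0^'+] --> (- 1) ^+ k * - laplace_moment k.+1 a.
  by apply: cvgM; [exact: cvg_cst|exact: laplace_moment_right_derivative].
apply: cvg_trans; apply: near_eq_cvg; near=> h.
rewrite !fE //; first by ring.
by rewrite addr_ge0.
Unshelve. all: by end_near. Qed.

Lemma halfline_deriven_laplace k (a : R) : (k <= p)%N -> 0 <= a ->
  halfline_deriven k (laplace_moment 0) a = (- 1) ^+ k * laplace_moment k a.
Proof.
elim: k a => [|k IH] a kp a0; first by rewrite expr0 mul1r.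
rewrite /halfline_deriven iterS; apply: halfline_derive_laplace => // x x0.
by apply: IH => //; exact: ltnW.
Qed.

End Laplace.

(** * Independence of the individual offspring numbers *)

Section Partition.
Local Open Scope ereal_scope.
Context d (T : measurableType d) (R : realType) (P : probability T R).
Variables (X : {RV P >-> nat}) (A : set T).
Hypothesis mA : measurable A.

Lemma measurable_fiber x : measurable (A `&` X @^-1` [set x]).
Proof. by apply: measurableI => //; exact: measurable_funPTI. Qed.

Lemma fiber_bigcup : A = \bigcup_x (A `&` X @^-1` [set x]).
Proof.
by apply/seteqP; split=> [w Aw|w [x _ []//]]; exists (X w).
Qed.

Lemma trivIset_fiber : trivIset setT (fun x => A `&` X @^-1` [set x]).
Proof.
apply/trivIsetP => i j _ _ /negP ij; rewrite -subset0 => w [[_ /= Xi] [_ /= Xj]].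
by apply: ij; rewrite -Xi -Xj.
Qed.

Lemma integral_fibers (f : T -> \bar R) :
  measurable_fun A f -> (forall w, A w -> 0 <= f w) ->
  \int[P]_(w in A) f w = \sum_(x <oo) \int[P]_(w in A `&` X @^-1` [set x]) f w.
Proof.
move=> mf f0.
have := @ge0_integral_bigcup _ _ _ P (fun x => A `&` X @^-1` [set x]) f.
by rewrite /= -fiber_bigcup; apply => //;
  [exact: measurable_fiber|exact: trivIset_fiber].
Qed.

End Partition.

Lemma measurable_nat_fun d (T : measurableType d) (R : realType)
    (P : probability T R) (X : {RV P >-> nat}) (f : nat -> R) (A : set T) :
  measurable_fun A (fun w => f (X w)).
Proof. by apply: measurableT_comp => //; exact: measurable_funP. Qed.

Section Independence.
Local Open Scope ereal_scope.
Context d (T : measurableType d) (R : realType) (P : probability T R).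
Variables (xi : nat * nat -> {RV P >-> nat}) (q : nat -> R).
Hypotheses (indep : mutually_independent xi)
  (law : forall i j, P (xi i @^-1` [set j]) = (q j)%:E).

Definition independent_of (S : set (nat * nat)) (A : set T) : Prop :=
  measurable A /\ forall (J : seq (nat * nat)) (B : nat * nat -> set nat),
    uniq J -> [set` J] `<=` S ->
    P (A `&` \bigcap_(i in [set` J]) (xi i @^-1` B i)) =
    P A * \prod_(i <- J) P (xi i @^-1` B i).

Lemma sub_independent_of S S' A : S `<=` S' ->
  independent_of S' A -> independent_of S A.
Proof.
by move=> SS [mA iA]; split=> // J B uJ JS; apply: iA => //; exact: subset_trans SS.
Qed.

Lemma independent_of_setT S : independent_of S setT.
Proof.
split=> // J B uJ _; rewrite setTI probability_setT mul1e.
exact: indep.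
Qed.

Lemma independent_of_set0 S : independent_of S set0.
Proof. by split=> // J B _ _; rewrite set0I measure0 mul0e. Qed.

Lemma independent_of_law S A i j : S i -> independent_of S A ->
  P (A `&` xi i @^-1` [set j]) = P A * (q j)%:E.
Proof.
move=> Si [mA iA]; have := iA [:: i] (fun=> [set j]) isT.
rewrite big_seq1 law => <- //; last by move=> k /=; rewrite inE => /eqP ->.
congr (P (_ `&` _)); apply/seteqP; split=> [w xw k /=|w /(_ i)]; last first.
  by apply; rewrite /= inE.
by rewrite inE => /eqP ->.
Qed.

Lemma independent_of_fiber S A i j : S i -> independent_of S A ->
  independent_of (S `\ i) (A `&` xi i @^-1` [set j]).
Proof.
move=> Si iA; have [mA PA] := iA; split.
  by apply: measurableI => //; exact: measurable_funPTI.
move=> J B uJ JS; have iJ : i \notin J.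
  by apply/negP => /JS[] _; apply.
pose B' k := if k == i then [set j] else B k.
have := PA (i :: J) B'; rewrite /= iJ uJ => /(_ isT).
rewrite big_cons {2}/B' eqxx law muleA -(independent_of_law j Si iA).
have -> : \prod_(k <- J) P (xi k @^-1` B' k) = \prod_(k <- J) P (xi k @^-1` B k).
  rewrite big_seq [RHS]big_seq; apply: eq_bigr => k kJ; rewrite /B'.
  by case: eqP => // ki; move: kJ iJ; rewrite ki => ->.
move=> <-; last first.
  by move=> k /=; rewrite inE => /orP[/eqP -> //|kJ]; have [] := JS k kJ.
rewrite -setIA; congr (P (_ `&` _)); apply/seteqP; split=> w.
  move=> [xw Bw] k /=; rewrite inE /B'; case: eqP => [-> _ //|_ /= kJ].
  exact: Bw.
move=> h; split=> [|k kJ]; first by have := h i; rewrite /B' /= eqxx inE eqxx; exact.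
have /= := h k; rewrite inE kJ orbT /B' => /(_ isT).
by case: eqP kJ => // -> /=; rewrite (negbTE iJ).
Qed.

Lemma independent_of_bigcup S (F : nat -> set T) :
  (forall k, independent_of S (F k)) -> trivIset setT F ->
  independent_of S (\bigcup_k F k).
Proof.
move=> iF tF; have mF k : measurable (F k) by case: (iF k).
have mU : measurable (\bigcup_k F k) by exact: bigcupT_measurable.
split=> // J B uJ JS.
set E := \bigcap_(i in _) _.
have mE : measurable E.
  by apply: fin_bigcap_measurable => // i _; exact: measurable_funPTI.
have <- : P E = \prod_(i <- J) P (xi i @^-1` B i) by exact: indep.
rewrite setI_bigcupl measure_semi_bigcup; last 3 first.
- by move=> k; exact: measurableI.
- exact: trivIset_setIr.
- by rewrite -setI_bigcupl; exact: measurableI.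
rewrite measure_semi_bigcup // muleC -[P E]fineK ?fin_num_measure //.
rewrite -nneseriesZl //; apply: eq_eseriesr => k _.
rewrite muleC fineK ?fin_num_measure //.
have [_ /(_ J B uJ JS) Fk] := iF k; apply: (etrans Fk); congr (_ * _).
by apply/esym; exact: indep.
Qed.

(** The individuals that come after the first x of generation n when the
    generations are listed one after the other. *)
Definition later (n x : nat) : set (nat * nat) :=
  [set i | (n < i.1)%N || ((i.1 == n) && (x <= i.2)%N)].

Lemma independent_of_child n x A j : independent_of (later n x) A ->
  independent_of (later n x.+1) (A `&` xi (n, x) @^-1` [set j]).
Proof.
move=> iA; apply: (@sub_independent_of _ (later n x `\ (n, x))).
  move=> [m k] /= h; split; rewrite /later /= in h *.
    by case: ltngtP h => //= _; exact: ltnW.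
  by case=> mn kx; move: h; rewrite mn kx ltnn eqxx /= ltnn.
by apply: independent_of_fiber => //; rewrite /later /= eqxx leqnn orbT.
Qed.

(** Splitting according to the number of children of the last individual keeps
    every event of the decomposition independent of the remaining ones. *)
Lemma independent_of_children_sum n A : independent_of (later n 0) A ->
  forall x y, independent_of (later n x)
    (A `&` [set w | (\sum_(k < x) xi (n, val k) w)%N = y]).
Proof.
move=> iA; elim=> [|x IH] y.
  case: (eqVneq y 0%N) => [->|y0].
    by rewrite (_ : [set w | _] = setT) ?setIT //; apply/seteqP; split=> w //=;
      rewrite big_ord0.
  rewrite (_ : [set w | _] = set0) ?setI0; first exact: independent_of_set0.
  by rewrite -subset0 => w /=; rewrite big_ord0 => /esym/eqP; exact/negP.
pose F v := if (v <= y)%N then (A `&`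
  [set w | (\sum_(k < x) xi (n, val k) w)%N = (y - v)%N])
  `&` xi (n, x) @^-1` [set v] else set0.
rewrite (_ : _ `&` _ = \bigcup_v F v).
  apply: independent_of_bigcup => [v|].
    rewrite /F; case: ifP => _; last exact: independent_of_set0.
    exact: independent_of_child.
  apply/trivIsetP => i j _ _ /negP ij; rewrite -subset0 => w; rewrite /F.
  case: ifP => _; last by case.
  case: ifP => _ [[_ /= Xi]] // [_ /= Xj].
  by apply: ij; rewrite -Xi -Xj.
apply/seteqP; split=> w.
  move=> [Aw /=]; rewrite big_ord_recr /= => yE.
  exists (xi (n, x) w) => //; rewrite /F -yE leq_addl addnK.
  by split.
move=> [v _]; rewrite /F; case: ifP => // vy [[Aw /= s] xv]; split=> //=.
by rewrite big_ord_recr /= s xv subnK.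
Qed.

(** The product rule for independent variables, obtained by conditioning on one
    child at a time. *)
Lemma integral_children n (g : nat -> R) (m : R) :
  (forall j, 0 <= g j)%R -> \sum_(j <oo) (g j * q j)%:E = m%:E ->
  forall x K A, independent_of (later n K) A ->
  \int[P]_(w in A) (\prod_(k < x) g (xi (n, K + k)%N w))%:E = P A * (m ^+ x)%:E.
Proof.
move=> g0 gm; elim=> [|x IH] K A iA; have [mA _] := iA.
  under eq_integral do rewrite big_ord0.
  by rewrite integral_cst // mul1e expr0 mule1.
have mprod K' z (B : set T) : measurable_fun B
    (fun w => (\prod_(k < z) g (xi (n, K' + k)%N w))%:E).
  apply/measurable_EFinP.
  by apply: measurable_prod => k _; exact: measurable_nat_fun.
rewrite (integral_fibers (xi (n, K)) mA) //; last first.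
  by move=> w _; rewrite lee_fin prodr_ge0.
transitivity (\sum_(j <oo) (fine (P A) * m ^+ x)%:E * (g j * q j)%:E).
  apply: eq_eseriesr => j _.
  transitivity (\int[P]_(w in A `&` xi (n, K) @^-1` [set j])
      ((g j)%:E * (\prod_(k < x) g (xi (n, K.+1 + k)%N w))%:E)).
    apply: eq_integral => w /[!inE] -[_ /= Xj].
    rewrite big_ord_recl /= addn0 Xj EFinM; congr (_ * _%:E).
    by apply: eq_bigr => k _; rewrite /bump /= add1n addSnnS.
  have q0 : (0 <= q j)%R by rewrite -lee_fin -(law (n, K) j).
  rewrite ge0_integralZl_EFin //; last 2 first.
  - exact: measurable_fiber.
  - by move=> w _; rewrite lee_fin prodr_ge0.
  rewrite IH; last exact: independent_of_child.
  rewrite (independent_of_law _ _ iA) ?/later /= ?eqxx ?leqnn ?orbT //.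
  rewrite -[P A]fineK ?fin_num_measure //= -!EFinM; congr EFin; ring.
have q0 j : (0 <= q j)%R by rewrite -lee_fin -(law (n, K) j).
rewrite nneseriesZl; last by move=> j _; rewrite lee_fin mulr_ge0.
rewrite gm -[P A]fineK ?fin_num_measure //= -!EFinM exprSr.
by rewrite mulrA.
Qed.

Lemma integral_offspring i (g : nat -> R) : (forall j, 0 <= g j)%R ->
  \int[P]_w (g (xi i w))%:E = \sum_(j <oo) (g j * q j)%:E.
Proof.
move=> g0; rewrite (integral_fibers (xi i) measurableT); last 2 first.
- by apply/measurable_EFinP; exact: measurable_nat_fun.
- by move=> w _; rewrite lee_fin.
apply: eq_eseriesr => j _; rewrite EFinM -(law i j).
transitivity (\int[P]_(w in setT `&` xi i @^-1` [set j]) (g j)%:E).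
  by apply: eq_integral => w /[!inE] -[_ /= ->].
by rewrite integral_cst ?setTI //; exact: measurable_funPTI.
Qed.

End Independence.

(** * The branching property *)

Section Branching.
Local Open Scope ereal_scope.
Context d (T : measurableType d) (R : realType) (P : probability T R).
Variables (q : nat -> R) (Z : nat -> {RV P >-> nat}).
Variable xi : nat * nat -> {RV P >-> nat}.
Hypotheses (indep : mutually_independent xi)
  (law : forall i j, P (xi i @^-1` [set j]) = (q j)%:E)
  (Z0 : forall w, Z 0%N w = 1%N)
  (ZS : forall n w, Z n.+1 w = (\sum_(k < Z n w) xi (n, val k) w)%N).

Fixpoint history n (w : T) : seq nat :=
  Z n w :: (if n is n'.+1 then history n' w else [::]).

(** Events determined by Z_0, ..., Z_n. The process takes countably many values,
    so such an event is a countable union of histories and its measurability is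
    automatic. *)
Definition past_event n (L : set T) : Prop :=
  forall w w', history n w = history n w' -> L w -> L w'.

Lemma history_inj n w w' k : (k <= n)%N ->
  history n w = history n w' -> Z k w = Z k w'.
Proof.
elim: n => [|n IH]; first by rewrite leqn0 => /eqP -> [].
by rewrite leq_eqVlt => /orP[/eqP -> []//|kn /= [_ /IH]]; apply.
Qed.

Lemma past_eventS n L : past_event n L -> past_event n.+1 L.
Proof. by move=> nL w w' /= [_]; exact: nL. Qed.

Lemma past_eventD n m L : past_event n L -> past_event (n + m) L.
Proof.
by move=> nL; elim: m => [|m IH]; rewrite ?addn0 // addnS; exact: past_eventS.
Qed.

Lemma past_event_fiber n L x :
  past_event n L -> past_event n (L `&` Z n @^-1` [set x]).
Proof.
move=> nL w w' hw [Lw /= <-]; split; first exact: nL Lw.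
exact/esym/(history_inj (leqnn n)).
Qed.

Lemma natural_filtration_past_event n L :
  natural_filtration Z n L -> past_event n L.
Proof.
apply: smallest_sub.
  split=> [w w' _ //|A nA w w' hw [_ Aw]|F nF w w' hw [k _ Fw]].
  - by split=> // Aw'; apply: Aw; exact: nA Aw'.
  - by exists k => //; exact: nF Fw.
move=> A; rewrite -bigcup_mkord_ord => -[k /= kn [B _ <-]] w w' hw [_ Bw].
split=> //=; rewrite /preimage /= in Bw *.
by rewrite -(history_inj _ hw) // -ltnS ltn_ord.
Qed.

(** Given the history up to n, the size of generation n + 1 is a sum of a fixed
    number of offspring variables that have not been used yet. *)
Lemma history_independent n h :
  independent_of xi (later n 0) (history n @^-1` [set h]).
Proof.
elim: n h => [|n IH] h.
  case: (eqVneq h [:: 1%N]) => [->|h1].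
    rewrite (_ : _ @^-1` _ = setT); first exact: independent_of_setT.
    by apply/seteqP; split=> w //= _; rewrite Z0.
  rewrite (_ : _ @^-1` _ = set0); first exact: independent_of_set0.
  by rewrite -subset0 => w /=; rewrite Z0 => /esym/eqP; exact/negP.
case: h => [|y h].
  rewrite (_ : _ @^-1` _ = set0); first exact: independent_of_set0.
  by rewrite -subset0.
have -> : history n.+1 @^-1` [set y :: h] = history n @^-1` [set h] `&`
    [set w | (\sum_(k < head 0%N h) xi (n, val k) w)%N = y].
  have hd w : head 0%N (history n w) = Z n w by case: n {IH}.
  apply/seteqP; split=> w /=.
    by case=> <- <-; rewrite hd -ZS.
  by case=> <-; rewrite hd -ZS => ->.
apply: sub_independent_of (independent_of_children_sum indep law (IH h) _ y).
by move=> [m k]; rewrite /later /= => /orP[/ltnW -> //|/andP[/eqP -> _]];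
   rewrite leqnn.
Qed.

Lemma past_event_independent n L :
  past_event n L -> independent_of xi (later n 0) L.
Proof.
move=> nL.
(* pickle_inv enumerates the histories without repetition, which makes the
   sets F c disjoint. *)
pose F (c : nat) := if pickle_inv c is Some h then
  (if `[< (history n @` L) h >] then history n @^-1` [set h] else set0)
  else set0.
rewrite (_ : L = \bigcup_c F c).
  apply: independent_of_bigcup => // [c|].
    rewrite /F; case: pickle_inv => [h|]; last exact: independent_of_set0.
    by case: ifP => _; [exact: history_independent|exact: independent_of_set0].
  apply/trivIsetP => i j _ _ /negP ij; rewrite -subset0 => w; rewrite /F.
  case Ei: pickle_inv => [h|]; last by case.
  case Ej: pickle_inv => [h'|]; last by case.
  case: ifP => _ [] //; case: ifP => _ // /= hw hw'; apply: ij.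
  have := @pickle_invK (seq nat) i; have := @pickle_invK (seq nat) j.
  by rewrite Ei Ej /= => <- <-; rewrite -hw -hw'.
apply/seteqP; split=> w.
  move=> Lw; exists (pickle (history n w)) => //.
  by rewrite /F pickleK_inv ifT //; apply/asboolP; exists w.
move=> [c _]; rewrite /F; case: pickle_inv => // h.
case: ifPn => // /asboolP[w' Lw'].
by move=> <- /= /esym hw; exact: nL Lw'.
Qed.

Lemma measurable_past_event n L : past_event n L -> measurable L.
Proof. by case/past_event_independent. Qed.

Definition offspring_pgf (s : R) : R := \int[P]_w (s ^+ xi (0%N, 0%N) w).

Lemma offspring_pgfE s : (0 <= s <= 1)%R ->
  \sum_(j <oo) (s ^+ j * q j)%:E = (offspring_pgf s)%:E.
Proof.
move=> /andP[s0 s1]; rewrite -(integral_offspring law (0%N, 0%N)); last first.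
  by move=> j; exact: exprn_ge0.
rewrite /offspring_pgf /Rintegral fineK // integrable_fin_num //.
apply: le_integrable (finite_measure_integrable_cst P 1%R measurableT) => //.
  by apply/measurable_EFinP; exact: (measurable_nat_fun _ (fun j => s ^+ j)%R).
move=> w _ /=; rewrite lee_fin normr1 ger0_norm ?exprn_ge0 //.
exact: exprn_ile1.
Qed.

Lemma offspring_pgf_itv s : (0 <= s <= 1)%R -> (0 <= offspring_pgf s <= 1)%R.
Proof.
move=> s01; have /andP[s0 s1] := s01.
rewrite Rintegral_ge0 //=; last by move=> w _; exact: exprn_ge0.
rewrite -lee_fin -offspring_pgfE // -(integral_offspring law (0%N, 0%N)); last first.
  by move=> j; exact: exprn_ge0.
have <- : \int[P]_w 1%:E = 1 by rewrite integral_cst //= probability_setT mul1e.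
apply: ge0_le_integral => //.
- by move=> w _; rewrite lee_fin exprn_ge0.
- by apply/measurable_EFinP; exact: (measurable_nat_fun _ (fun j => s ^+ j)%R).
- by move=> w _; rewrite lee_fin exprn_ile1.
Qed.

(** Given Z_n = x, the next generation is a sum of x independent copies of the
    offspring variable. *)
Lemma integral_pgf_fiber n L x s : past_event n L -> (0 <= s <= 1)%R ->
  \int[P]_(w in L `&` Z n @^-1` [set x]) (s ^+ Z n.+1 w)%:E =
  P (L `&` Z n @^-1` [set x]) * (offspring_pgf s ^+ x)%:E.
Proof.
move=> nL s01; have /andP[s0 s1] := s01.
have iA := past_event_independent (past_event_fiber (x := x) nL).
rewrite -(integral_children law (fun j => exprn_ge0 j s0)
  (offspring_pgfE s01) x iA).
apply: eq_integral => w /[!inE] -[_ /= Zx]; congr EFin.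
by rewrite ZS Zx -prodrXr.
Qed.

Lemma integral_pgf_step n L s : past_event n L -> (0 <= s <= 1)%R ->
  \int[P]_(w in L) (s ^+ Z n.+1 w)%:E =
  \int[P]_(w in L) (offspring_pgf s ^+ Z n w)%:E.
Proof.
move=> nL s01; have /andP[s0 s1] := s01.
have /andP[f0 f1] := offspring_pgf_itv s01.
have mL := measurable_past_event nL.
rewrite (integral_fibers (Z n) mL); last 2 first.
- by apply/measurable_EFinP; exact: (measurable_nat_fun _ (fun j => s ^+ j)%R).
- by move=> w _; rewrite lee_fin exprn_ge0.
rewrite [RHS](integral_fibers (Z n) mL); last 2 first.
- by apply/measurable_EFinP; exact: (measurable_nat_fun _ (fun j => _ ^+ j)%R).
- by move=> w _; rewrite lee_fin exprn_ge0.
apply: eq_eseriesr => x _; rewrite integral_pgf_fiber //.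
rewrite muleC -integral_cst; last exact: measurable_fiber.
by apply: eq_integral => w /[!inE] -[_ /= ->].
Qed.

Lemma integral_pgf_iter n L m s : past_event n L -> (0 <= s <= 1)%R ->
  \int[P]_(w in L) (s ^+ Z (m + n)%N w)%:E =
  \int[P]_(w in L) (iter m offspring_pgf s ^+ Z n w)%:E.
Proof.
move=> nL; elim: m s => [//|m IH] s s01.
have mL : past_event (m + n) L by rewrite addnC; exact: past_eventD.
by rewrite (integral_pgf_step mL s01) IH ?iterSr //; exact: offspring_pgf_itv.
Qed.

Lemma pgf_iter m s : (0 <= s <= 1)%R ->
  iter m offspring_pgf s = (\int[P]_w (s ^+ Z m w))%R.
Proof.
move=> s01; rewrite /Rintegral -[m in Z m]addn0 integral_pgf_iter //.
under eq_integral do rewrite Z0 expr1.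
by rewrite integral_cst //= probability_setT mule1.
Qed.

(** Given Z_n = x, generation m + n has the law of the sum of x independent
    copies of Z_m. Only generating functions are compared, so that no copies
    of the process have to be constructed. *)
Theorem branching_pgf n L x m s : past_event n L -> (0 <= s <= 1)%R ->
  \int[P]_(w in L `&` Z n @^-1` [set x]) (s ^+ Z (m + n)%N w)%:E =
  P (L `&` Z n @^-1` [set x]) * ((\int[P]_w (s ^+ Z m w))%R ^+ x)%:E.
Proof.
move=> nL s01; have nLx := past_event_fiber (x := x) nL.
rewrite integral_pgf_iter // pgf_iter // muleC.
rewrite -integral_cst; last exact: measurable_past_event nLx.
by apply: eq_integral => w /[!inE] -[_ /= ->].
Qed.

End Branching.

(** * Moments of one generation *)

Lemma ffact_le_expn n m : (n ^_ m <= n ^ m)%N.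
Proof.
elim: m => [|m IH]; first by rewrite ffactn0.
by rewrite ffactnSr expnSr leq_mul // leq_subr.
Qed.

Lemma bin_le_expn n m : ('C(n, m) <= n ^ m)%N.
Proof.
by rewrite (leq_trans _ (ffact_le_expn n m)) // -bin_ffact leq_pmulr ?fact_gt0.
Qed.

Section NonnegativeCoefficients.
Variables (R : realType) (C : {poly R}).
Hypothesis C0 : forall k, 0 <= C`_k.

Lemma coef_exp_ge0 n k : 0 <= (C ^+ n)`_k.
Proof.
elim: n k => [|n IH] k; first by rewrite expr0 coefC; case: ifP.
by rewrite exprS coefM sumr_ge0 // => i _; rewrite mulr_ge0.
Qed.

End NonnegativeCoefficients.

Section LeadingBinomial.
Variables (R : realType) (C : {poly R}).
Hypothesis C0 : forall k, 0 <= C`_k.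

Let E0 k i : 0 <= (drop_poly 1 C ^+ i)`_k.
Proof. by apply: coef_exp_ge0 => j; rewrite coef_drop_poly. Qed.

Let Etop p : (drop_poly 1 C ^+ p)`_0 = C`_1 ^+ p.
Proof. by rewrite coef0_exp coef_drop_poly. Qed.

(** The term i = p of the binomial expansion, all others being nonnegative. *)
Lemma coef_exp_ge_leading p x :
  'C(x, p)%:R * C`_0 ^+ (x - p) * C`_1 ^+ p <= (C ^+ x)`_p.
Proof.
rewrite coef_exp_split big_ord_recr /= subnn Etop lerDr.
by apply: sumr_ge0 => i _; rewrite !mulr_ge0 ?exprn_ge0.
Qed.

(** For 0 < i < p the binomial of x over i is at most x^(p-1), and the term i = 0
    vanishes; the term i = p is the leading one. *)
Lemma coef_exp_le_leading p : (0 < p)%N -> C`_0 = 1 ->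
  exists2 K, 0 <= K & forall x,
    p`!%:R * (C ^+ x)`_p <= C`_1 ^+ p * x%:R ^+ p + K * x%:R ^+ p.-1.
Proof.
case: p => // p _ C1.
exists (p.+1`!%:R * \sum_(i < p) (drop_poly 1 C ^+ i.+1)`_(p.+1 - i.+1)).
  by rewrite mulr_ge0 ?sumr_ge0.
move=> x; rewrite coef_exp_split big_ord_recr big_ord_recl /= subnn Etop.
rewrite expr0 subn0 coefC /= mulr0 add0r C1 mulrDr addrC lerD //.
  rewrite expr1n mulr1 mulrA -natrM mulrC ler_wpM2l ?exprn_ge0 //.
  by rewrite -natrX ler_nat mulnC bin_ffact ffact_le_expn.
rewrite -mulrA ler_wpM2l // mulr_suml; apply: ler_sum => i _.
rewrite expr1n mulr1 mulrC ler_wpM2l // -natrX ler_nat.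
case: x => [|x]; first by rewrite bin0n.
by rewrite (leq_trans (bin_le_expn _ _)) // leq_pexp2l.
Qed.

End LeadingBinomial.

Lemma expn_sum_le x (a : 'I_x -> nat) p : (0 < p)%N ->
  ((\sum_k a k) ^ p <= x ^ p * \sum_k a k ^ p)%N.
Proof.
move=> p0; case: x a => [|x] a; first by rewrite big_ord0 exp0n.
pose k0 := [arg max_(k > ord0) a k].
have ak0 k : (a k <= a k0)%N.
  by rewrite /k0; case: arg_maxnP => // i _ /(_ k); exact.
rewrite (@leq_trans ((x.+1 * a k0) ^ p)) ?leq_exp2r //.
  by rewrite -[x.+1 in leqRHS]card_ord -sum_nat_const leq_sum.
by rewrite expnMn leq_mul2l (bigD1 k0) //= leq_addr orbT.
Qed.

Section PowerLaw.
Context d (T : measurableType d) (R : realType) (P : probability T R).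
Variables (V V' : T -> R) (A : set T) (p x : nat) (c : R).
Hypotheses (mV : measurable_fun setT V) (V0 : forall w, 0 <= V w)
  (mA : measurable A) (Vp : P.-integrable A (fun w => (V w ^+ p)%:E)).
Hypotheses (mV' : measurable_fun setT V') (V'0 : forall w, 0 <= V' w)
  (Vp' : P.-integrable setT (fun w => (V' w ^+ p)%:E)).
Hypothesis power_law : forall a, 0 <= a ->
  laplace_moment P V A 0 a = c * laplace_moment P V' setT 0 a ^+ x.

(** If the Laplace transform of V on A is, on the whole half-line, a multiple of
    the x-th power of that of V', then the same holds for the jets, because
    both sides are jets with the same coefficient of order 0. This turns
    statements about sums of independent variables into moment formulas
    without expanding any power of a sum. *)
Lemma laplace_jet_power k a : (k <= p)%N -> 0 <= a ->
  (laplace_jet P V A p a)`_k = c * (laplace_jet P V' setT p a ^+ x)`_k.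
Proof.
move=> kp a0; rewrite -coefCM.
apply: (@jet_unique _ p _ (fun b => c%:P * laplace_jet P V' setT p b ^+ x)) => //.
- exact: jet_laplace.
- by apply: jetM; [exact: jet_cst|apply: jetX; exact: jet_laplace].
- move=> b b0; rewrite coefCM coef0_exp !coef_poly /= fact0 !divr1.
  exact: power_law.
Qed.

End PowerLaw.

Section Moments.
Context d (T : measurableType d) (R : realType) (P : probability T R).
Variables (q : nat -> R) (Z : nat -> {RV P >-> nat}).
Variable xi : nat * nat -> {RV P >-> nat}.
Hypotheses (indep : mutually_independent xi)
  (law : forall i j, P (xi i @^-1` [set j]) = (q j)%:E)
  (Z0 : forall w, Z 0%N w = 1%N)
  (ZS : forall n w, Z n.+1 w = (\sum_(k < Z n w) xi (n, val k) w)%N).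

Let xi0 (w : T) : R := (xi (0%N, 0%N) w)%:R.

Let mxi0 : measurable_fun setT xi0.
Proof. exact: (measurable_nat_fun _ (fun j => j%:R)). Qed.

Let xi00 w : 0 <= xi0 w. Proof. exact: ler0n. Qed.

Lemma integral_moment i p :
  (\int[P]_w ((xi i w)%:R ^+ p)%:E = moment q p)%E.
Proof.
apply: (integral_offspring law i (g := fun j : nat => j%:R ^+ p)) => j.
exact: exprn_ge0.
Qed.

Section FiniteMoment.
Variable p : nat.
Hypotheses (p0 : (0 < p)%N) (qp : (moment q p < +oo)%E).

Let integrable_xi i : P.-integrable setT (fun w => ((xi i w)%:R ^+ p)%:E).
Proof.
apply/integrableP; split.
  by apply/measurable_EFinP; exact: (measurable_nat_fun _ (fun j => j%:R ^+ p)).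
under eq_integral do rewrite gee0_abs ?lee_fin ?exprn_ge0 //.
by rewrite integral_moment.
Qed.

Definition offspring_jet : {poly R} := laplace_jet P xi0 setT p 0.

Lemma offspring_jetE k : (k <= p)%N -> offspring_jet`_k = fine (moment q k) / k`!%:R.
Proof.
move=> kp; rewrite coef_poly ltnS kp /laplace_moment -(integral_moment (0%N, 0%N)).
by congr (_ / _); apply: eq_Rintegral => w _; rewrite mul0r oppr0 expR0 mulr1.
Qed.

Lemma integrable_next_generation n L x : past_event Z n L ->
  P.-integrable (L `&` Z n @^-1` [set x]) (fun w => ((Z n.+1 w)%:R ^+ p)%:E).
Proof.
move=> nL; have nLx := past_event_fiber (x := x) nL.
have mLx := measurable_past_event indep law Z0 ZS nLx.
apply: (@le_integrable _ _ _ _ _ mLx _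
  (fun w => (x%:R ^+ p)%:E * \sum_(k < x) ((xi (n, val k) w)%:R ^+ p)%:E)%E).
- by apply/measurable_EFinP; exact: (measurable_nat_fun _ (fun j => j%:R ^+ p)).
- move=> w [_ /= Zx]; rewrite sumEFin -EFinM lee_fin.
  rewrite !ger0_norm ?exprn_ge0 //; last first.
    by rewrite mulr_ge0 ?exprn_ge0 ?sumr_ge0 // => k _; exact: exprn_ge0.
  have -> : \sum_(k < x) (xi (n, val k) w)%:R ^+ p =
      (\sum_(k < x) xi (n, val k) w ^ p)%:R :> R.
    by rewrite natr_sum; apply: eq_bigr => k _; rewrite natrX.
  by rewrite ZS Zx -!natrX -natrM ler_nat expn_sum_le.
- apply: integrableZl => //; apply: integrable_sum => // k.
  by move=> _; exact: (integrableS measurableT mLx (@subsetT _ _) (integrable_xi _)).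
Qed.

(** The moment of a sum of x independent offspring variables, read off the
    Laplace transforms at 0. *)
Lemma moment_fiber n L x : past_event Z n L ->
  (\int[P]_(w in L `&` Z n @^-1` [set x]) ((Z n.+1 w)%:R ^+ p)%:E =
  P (L `&` Z n @^-1` [set x]) * (p`!%:R * (offspring_jet ^+ x)`_p)%:E)%E.
Proof.
move=> nL; set A := L `&` _; have nLx := past_event_fiber (x := x) nL.
have mA := measurable_past_event indep law Z0 ZS nLx.
have iZ := integrable_next_generation x nL.
pose V w : R := (Z n.+1 w)%:R.
have expE a j : expR (- (a * j%:R)) = expR (- a) ^+ j :> R.
  by rewrite -expRM_natr mulNr.
have law0 a : 0 <= a -> laplace_moment P V A 0 a =
    fine (P A) * laplace_moment P xi0 setT 0 a ^+ x.
  move=> a0; have s01 : 0 <= expR (- a) <= 1 by rewrite expR_ge0 expRN_le1.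
  have := integral_pgf_fiber indep law Z0 ZS x nL s01; rewrite -/A => H.
  rewrite /laplace_moment /Rintegral.
  have -> : (\int[P]_(w in A) (V w ^+ 0 * expR (- (a * V w)))%:E =
      \int[P]_(w in A) (expR (- a) ^+ Z n.+1 w)%:E)%E.
    by apply: eq_integral => w _; rewrite expr0 mul1r expE.
  rewrite H fineM ?fin_num_measure //=; congr (_ * _ ^+ _).
  by apply: eq_Rintegral => w _; rewrite expr0 mul1r expE.
have mV : measurable_fun setT V by exact: (measurable_nat_fun _ (fun j => j%:R)).
have V0 w : 0 <= V w by exact: ler0n.
have := @laplace_jet_power _ _ _ P V xi0 A p x _ mV V0 mA iZ mxi0 xi00
  (integrable_xi _) law0 p 0 (leqnn p) (lexx 0).
rewrite coef_poly ltnS leqnn => /(congr1 (fun r => r * p`!%:R)).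
rewrite divfK ?pnatr_eq0 -?lt0n ?fact_gt0 // => H.
rewrite -[P A]fineK ?fin_num_measure // -EFinM [p`!%:R * _]mulrC mulrA -H.
rewrite /laplace_moment /Rintegral fineK.
  by apply: eq_integral => w _; rewrite mul0r oppr0 expR0 mulr1.
have := integrable_fin_num mA (integrable_laplace mV V0 mA iZ (leqnn p) (lexx 0)).
by [].
Qed.

End FiniteMoment.
End Moments.

(** * Growth of the moments of the process *)

Section MomentGrowth.
Local Open Scope ereal_scope.
Context d (T : measurableType d) (R : realType) (P : probability T R).
Variables (q : nat -> R) (Z : nat -> {RV P >-> nat}).
Variable xi : nat * nat -> {RV P >-> nat}.
Hypotheses (indep : mutually_independent xi)
  (law : forall i j, P (xi i @^-1` [set j]) = (q j)%:E)
  (Z0 : forall w, Z 0%N w = 1%N)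
  (ZS : forall n w, Z n.+1 w = (\sum_(k < Z n w) xi (n, val k) w)%N).
Hypothesis q1 : moment q 1 < +oo.
Hypothesis mu_gt1 : (1 < mean q)%R.

Let mu : R := mean q.

Lemma moment_le p k : (k <= p)%N -> moment q p < +oo -> moment q k < +oo.
Proof.
move=> kp qp; pose i0 := (0%N, 0%N).
pose V w : R := (xi i0 w)%:R.
have mV : measurable_fun setT V by exact: (measurable_nat_fun _ (fun j => j%:R)).
have V0 w : (0 <= V w)%R by exact: ler0n.
rewrite -(integral_moment law i0); apply: (integrable_lty measurableT).
apply: (integrable_power mV V0 measurableT _ kp).
apply/integrableP; split.
  by apply/measurable_EFinP; exact: measurable_funX.
under eq_integral do rewrite gee0_abs ?lee_fin ?exprn_ge0 //.
by rewrite (integral_moment law i0).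
Qed.

Let offspring_jet p := offspring_jet xi p.

Lemma offspring_jet0 p : (offspring_jet p)`_0 = 1%R.
Proof.
rewrite (offspring_jetE law) // fact0 divr1 -(integral_moment law (0%N, 0%N)).
under eq_integral do rewrite expr0.
by rewrite integral_cst //= probability_setT mul1e.
Qed.

Lemma offspring_jet1 p : (0 < p)%N -> (offspring_jet p)`_1 = mu.
Proof.
by move=> p0; rewrite (offspring_jetE law) // factS fact0 muln1 mulr1n divr1.
Qed.

Lemma offspring_jet_ge0 p k : (0 <= (offspring_jet p)`_k)%R.
Proof.
rewrite coef_poly; case: ifP => // _; rewrite divr_ge0 //.
by apply: laplace_moment_ge0 => w; exact: ler0n.
Qed.

Lemma integral_mean_step n L : past_event Z n L ->
  \int[P]_(w in L) (Z n.+1 w)%:R%:E = mu%:E * \int[P]_(w in L) (Z n w)%:R%:E.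
Proof.
move=> nL; have mL := measurable_past_event indep law Z0 ZS nL.
have mZ m : measurable_fun L (fun w => (Z m w)%:R%:E : \bar R).
  by apply/measurable_EFinP; exact: (measurable_nat_fun _ (fun j => j%:R)).
have mu0 : (0 <= mu)%R := ltW (lt_trans ltr01 mu_gt1).
rewrite -(ge0_integralZl_EFin _ mL _ (mZ n) mu0) //.
rewrite (integral_fibers (Z n) mL) // [RHS](integral_fibers (Z n) mL); last 2 first.
- exact: measurable_funeM.
- by move=> w _; rewrite -EFinM lee_fin mulr_ge0.
apply: eq_eseriesr => x _.
have := moment_fiber indep law Z0 ZS (ltn0Sn 0) q1 x nL.
under eq_integral do rewrite expr1.
move=> ->; rewrite -/(offspring_jet 1) coef1_exp ?offspring_jet0 // offspring_jet1 //.
rewrite mul1r -mulr_natr muleC.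
rewrite -integral_cst; last exact: measurable_fiber.
by apply: eq_integral => w /[!inE] -[_ /= ->].
Qed.

(** The martingale property of Z_n / mu^n. *)
Lemma integral_mean_iter n m L : past_event Z n L ->
  \int[P]_(w in L) (Z (m + n)%N w)%:R%:E =
  (mu ^+ m)%:E * \int[P]_(w in L) (Z n w)%:R%:E.
Proof.
move=> nL; elim: m => [|m IH]; first by rewrite expr0 mul1e.
rewrite exprS EFinM -muleA -IH -integral_mean_step // addnC.
exact: past_eventD.
Qed.

Lemma integral_mean m : \int[P]_w (Z m w)%:R%:E = (mu ^+ m)%:E.
Proof.
rewrite -[m in Z m]addn0 integral_mean_iter //.
under eq_integral do rewrite Z0.
by rewrite integral_cst //= probability_setT !mule1.
Qed.

Lemma integral_power_step p : (0 < p)%N -> moment q p < +oo ->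
  exists2 K : R, (0 <= K)%R & forall n,
  \int[P]_w ((Z n.+1 w)%:R ^+ p)%:E <=
  (mu ^+ p)%:E * \int[P]_w ((Z n w)%:R ^+ p)%:E +
  K%:E * \int[P]_w ((Z n w)%:R ^+ p.-1)%:E.
Proof.
move=> p0 qp; have mu0 : (0 <= mu)%R := ltW (lt_trans ltr01 mu_gt1).
have [K K0 HK] := coef_exp_le_leading (offspring_jet_ge0 p) p0 (offspring_jet0 p).
exists K => // n.
have mZ k m : measurable_fun setT (fun w => ((Z m w)%:R ^+ k : R)%:E).
  by apply/measurable_EFinP; exact: (measurable_nat_fun _ (fun j => j%:R ^+ k)%R).
have Z_ge0 k m w : 0 <= ((Z m w)%:R ^+ k : R)%:E by rewrite lee_fin exprn_ge0.
rewrite -(ge0_integralZl_EFin _ measurableT _ (mZ p n) (exprn_ge0 p mu0)) //.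
rewrite -(ge0_integralZl_EFin _ measurableT _ (mZ p.-1 n) K0) //.
rewrite -ge0_integralD //; last 4 first.
- by move=> w _; rewrite -EFinM lee_fin mulr_ge0 ?exprn_ge0.
- exact: measurable_funeM.
- by move=> w _; rewrite -EFinM lee_fin mulr_ge0 ?exprn_ge0.
- exact: measurable_funeM.
rewrite (integral_fibers (Z n) measurableT (mZ p n.+1)) //.
rewrite [leRHS](integral_fibers (Z n) measurableT) //; last 2 first.
- by apply: emeasurable_funD; exact: measurable_funeM.
- by move=> w _; rewrite -!EFinM -EFinD lee_fin addr_ge0 ?mulr_ge0 ?exprn_ge0.
apply: lee_nneseries => x _.
  by move=> _; apply: integral_ge0 => w _; rewrite lee_fin exprn_ge0.
rewrite (moment_fiber indep law Z0 ZS p0 qp) //.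
apply: (@le_trans _ _ (P (setT `&` Z n @^-1` [set x]) *
   (mu ^+ p * x%:R ^+ p + K * x%:R ^+ p.-1)%:E)).
  by rewrite lee_wpmul2l // lee_fin -(offspring_jet1 p0) HK.
rewrite muleC -integral_cst; last exact: measurable_fiber.
rewrite le_eqVlt; apply/orP; left; apply/eqP.
by apply: eq_integral => w /[!inE] -[_ /= ->]; rewrite EFinD !EFinM.
Qed.

(** By induction on the order: in the recursion for the normalized moment of
    order p the increments are of order mu^(-n), hence summable. *)
Lemma integral_power_bound p : (0 < p)%N -> moment q p < +oo ->
  exists2 B : R, (0 <= B)%R & forall n,
  \int[P]_w ((Z n w)%:R ^+ p)%:E <= (B * mu ^+ (p * n))%:E.
Proof.
have mu0 : (0 < mu)%R := lt_trans ltr01 mu_gt1.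
case: p => // p _; elim: p => [_|p IH qp].
  exists 1%R => // n; under eq_integral do rewrite expr1.
  by rewrite integral_mean mul1r mul1n.
have [|B B0 HB] := IH; first exact: moment_le qp.
have [//|K K0 HK] := integral_power_step _ qp.
(* E is the sum of K B mu^-k over all k, and E (1 - mu^-n) that over k < n. *)
pose E : R := (K * B / (1 - mu^-1))%R.
have d0 : (0 < 1 - mu^-1)%R by rewrite subr_gt0 invf_lt1.
have E0 : (0 <= E)%R by rewrite divr_ge0 ?mulr_ge0 // ltW.
have EE : (E * (1 - mu^-1) = K * B)%R by rewrite divfK // gt_eqF.
exists (1 + E)%R; first by rewrite addr_ge0.
suff H n : \int[P]_w ((Z n w)%:R ^+ p.+2)%:E <=
    ((1 + E * (1 - mu ^- n)) * mu ^+ (p.+2 * n))%:E.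
  move=> n; apply: le_trans (H n) _.
  rewrite lee_fin ler_wpM2r ?exprn_ge0 ?(ltW mu0) //.
  by rewrite lerD2l ler_piMr // gerBl invr_ge0 exprn_ge0 // ltW.
elim: n => [|n IHn].
  under eq_integral do rewrite Z0 expr1n.
  rewrite integral_cst //= probability_setT mul1e muln0 !expr0 invr1 subrr.
  by rewrite mulr0 addr0 mulr1.
apply: le_trans (HK n) _.
apply: le_trans (leeD (lee_wpmul2l _ IHn) (lee_wpmul2l _ (HB n))) _.
- by rewrite lee_fin exprn_ge0 // ltW.
- by rewrite lee_fin.
rewrite -!EFinM -EFinD lee_fin.
set M := (mu ^+ n)%R; set N := (mu ^+ (p.+1 * n))%R; set Q := (mu ^+ p.+2)%R.
have e1 : (mu ^+ (p.+2 * n) = N * M)%R by rewrite -exprD mulSn addnC.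
have e2 : (mu ^+ (p.+2 * n.+1) = Q * (N * M))%R by rewrite mulnS exprD e1.
have e3 : (mu ^- n.+1 = mu^-1 * M^-1)%R by rewrite exprS invfM.
have M0 : M != 0%R by rewrite expf_neq0 // gt_eqF.
have Q1 : (1 <= Q)%R by rewrite exprn_ege1 // ltW.
rewrite e1 e2 e3 [(K * _)%R]mulrA -EE -subr_ge0.
have -> : ((1 + E * (1 - mu^-1 * M^-1)) * (Q * (N * M)) -
    (Q * ((1 + E * (1 - M^-1)) * (N * M)) + E * (1 - mu^-1) * N) =
    (Q - 1) * (E * (1 - mu^-1) * N))%R.
  by field; rewrite M0 gt_eqF.
by rewrite mulr_ge0 ?subr_ge0 // EE !mulr_ge0 // exprn_ge0 // ltW.
Qed.

End MomentGrowth.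

(** * Convergence in mean *)

Section LimitTheorems.
Context d (T : measurableType d) (R : realType) (P : probability T R).

Lemma fatou_bound (f_ : nat -> T -> R) (f : T -> R) (B : \bar R) :
  (forall n, measurable_fun setT (f_ n)) -> measurable_fun setT f ->
  (forall n w, 0 <= f_ n w) -> (forall w, 0 <= f w) ->
  {ae P, forall w, f_ n w @[n --> \oo] --> f w} ->
  (forall n, \int[P]_w (f_ n w)%:E <= B)%E -> (\int[P]_w (f w)%:E <= B)%E.
Proof.
move=> mf_ mf f_0 f0 ff fB.
have mF n : measurable_fun setT (EFin \o f_ n) by exact/measurable_EFinP.
have -> : (\int[P]_w (f w)%:E =
    \int[P]_w limn_einf ((fun n => EFin \o f_ n) ^~ w))%E.
  apply: ge0_ae_eq_integral => //.
  - exact/measurable_EFinP.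
  - apply: measurableT_comp => //; apply: measurable_fun_limn_esup => n.
    exact: measurableT_comp.
  - by move=> w _; rewrite lee_fin.
  - move=> w _; rewrite limn_einf_lim; apply: lime_ge; first exact: is_cvg_einfs.
    by apply: nearW => n; apply: le_ereal_inf_tmp => _ [k _ <-]; rewrite lee_fin.
  - apply: filterS ff => w fw _.
    have H : (EFin \o f_ ^~ w) n @[n --> \oo] --> (f w)%:E.
      by apply/fine_cvgP; split; [exact: nearW|exact: fw].
    by rewrite (cvg_limn_einf_sup H).1.
apply: (@le_trans _ _ (limn_einf (fun n => \int[P]_w (f_ n w)%:E)%E)).
  by apply: fatou => // n w _; rewrite lee_fin.
rewrite limn_einf_lim; apply: lime_le; first exact: is_cvg_einfs.
apply: nearW => n; apply: le_trans (fB n); apply: ereal_inf_lbound.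
by exists n => /=.
Qed.

(** The positive part of Y - Y_n is dominated by Y, so its integral tends to 0,
    and the negative part has no larger integral since the means of the Y_n do
    not exceed that of Y. *)
Lemma scheffe (Y_ : nat -> T -> R) (Y : T -> R) :
  (forall n, measurable_fun setT (Y_ n)) -> measurable_fun setT Y ->
  (forall n w, 0 <= Y_ n w) -> (forall w, 0 <= Y w) ->
  {ae P, forall w, Y_ n w @[n --> \oo] --> Y w} ->
  P.-integrable setT (EFin \o Y) ->
  (forall n, \int[P]_w (Y_ n w)%:E <= \int[P]_w (Y w)%:E)%E ->
  \int[P]_w `|Y_ n w - Y w| @[n --> \oo] --> 0.
Proof.
move=> mY_ mY Y_0 Y0 YY iY YleY.
have iY_ n : P.-integrable setT (EFin \o Y_ n).
  apply/integrableP; split; first exact/measurable_EFinP.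
  under eq_integral do rewrite gee0_abs ?lee_fin //.
  by apply: le_lt_trans (YleY n) _; exact: integrable_lty iY.
pose D n w := Num.max (Y w - Y_ n w) 0.
have mD n : measurable_fun setT (D n).
  by apply: measurable_maxr => //; exact: measurable_funB.
have D0 n w : 0 <= D n w by rewrite le_max lexx orbT.
have DY n w : D n w <= Y w.
  by rewrite ge_max Y0 andbT gerBl.
have Dcvg : \int[P]_w D n w @[n --> \oo] --> \int[P]_w (cst 0 w : R).
  apply: Rintegral_dominated_cvg iY _ => //.
    apply: filterS YY => w Yw _.
    have Yw0 : `|Y w - Y_ n w| @[n --> \oo] --> 0.
      have : `|Y w - Y_ n w| @[n --> \oo] --> `|Y w - Y w|.
        by apply: cvg_norm; apply: cvgB; [exact: cvg_cst|exact: Yw].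
      by rewrite subrr normr0.
    apply: (squeeze_cvgr _ (cvg_cst 0) Yw0); apply: nearW => n.
    by rewrite D0 /= ge_max normr_ge0 ler_norm.
  by move=> n w _; rewrite ger0_norm.
rewrite /= Rintegral_cst // mul0r in Dcvg.
have iD n : P.-integrable setT (EFin \o D n).
  apply: (le_integrable measurableT _ _ iY); first exact/measurable_EFinP.
  by move=> w _ /=; rewrite lee_fin !ger0_norm.
have D2 : 2 * \int[P]_w D n w @[n --> \oo] --> 0.
  by rewrite -(mulr0 2); apply: cvgM => //; exact: cvg_cst.
apply: (squeeze_cvgr _ (cvg_cst 0) D2); apply: nearW => n.
rewrite Rintegral_ge0 //=.
have -> : \int[P]_w `|Y_ n w - Y w| =
    \int[P]_w ((Y_ n w - Y w) + 2 * D n w).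
  apply: eq_Rintegral => w _; rewrite /D maxEle; case: leP => h.
    by rewrite mulr0 addr0 ger0_norm // -opprB oppr_ge0.
  by rewrite ltr0_norm ?opprB; [ring|rewrite -opprB oppr_lt0].
rewrite RintegralD //; last 2 first.
- exact: (integrableB measurableT (iY_ n) iY).
- exact: (integrableZl measurableT 2 (iD n)).
rewrite RintegralB // RintegralZl // gerDr subr_le0 fine_le //.
- exact: integrable_fin_num (iY_ n).
- exact: integrable_fin_num iY.
Qed.

(** Weights in [0, 1] can be inserted because the convergence in scheffe is in
    mean; the limit of the weights is then taken by domination by Y. *)
Lemma scheffe_weighted (Y_ g_ : nat -> T -> R) (Y g : T -> R) (A : set T) :
  measurable A ->
  (forall n, measurable_fun setT (Y_ n)) -> measurable_fun setT Y ->
  (forall n, measurable_fun setT (g_ n)) -> measurable_fun setT g ->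
  (forall n w, 0 <= Y_ n w) -> (forall w, 0 <= Y w) ->
  (forall n w, 0 <= g_ n w <= 1) ->
  {ae P, forall w, Y_ n w @[n --> \oo] --> Y w} ->
  {ae P, forall w, g_ n w @[n --> \oo] --> g w} ->
  P.-integrable setT (EFin \o Y) ->
  (forall n, \int[P]_w (Y_ n w)%:E <= \int[P]_w (Y w)%:E)%E ->
  \int[P]_(w in A) (Y_ n w * g_ n w) @[n --> \oo] -->
  \int[P]_(w in A) (Y w * g w).
Proof.
move=> mA mY_ mY mg_ mg Y_0 Y0 g01 YY gg iY YleY.
have S := scheffe mY_ mY Y_0 Y0 YY iY YleY.
have subT (f : T -> R) : measurable_fun setT f -> measurable_fun A f.
  by move=> mf; apply: measurable_funS mf.
have iY_ n : P.-integrable setT (EFin \o Y_ n).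
  apply/integrableP; split; first exact/measurable_EFinP.
  under eq_integral do rewrite gee0_abs ?lee_fin //.
  by apply: le_lt_trans (YleY n) _; exact: integrable_lty iY.
have iA f : P.-integrable setT (EFin \o f) -> P.-integrable A (EFin \o f).
  by move=> fT; apply: integrableS fT.
have g1 n w : `|g_ n w| <= 1 by have /andP[a b] := g01 n w; rewrite ger0_norm.
have Yg : \int[P]_(w in A) (Y w * g_ n w) @[n --> \oo] -->
    \int[P]_(w in A) (Y w * g w).
  apply: Rintegral_dominated_cvg (iA _ iY) _ => //.
  - by move=> n; apply: subT; exact: measurable_funM.
  - by apply: subT; exact: measurable_funM.
  - apply: filterS gg => w gw _; apply: cvgM => //; exact: cvg_cst.
  - by move=> n w _; rewrite normrM (ger0_norm (Y0 w)) ler_piMr.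
have i_ (f : T -> R) n : measurable_fun setT f -> P.-integrable setT (EFin \o f) ->
    P.-integrable A (EFin \o (fun w => f w * g_ n w)).
  move=> mf fT; apply: (le_integrable mA _ _ (iA _ fT)).
    by apply/measurable_EFinP; apply: subT; exact: measurable_funM.
  by move=> w _ /=; rewrite lee_fin normrM ler_piMr.
have D0 : \int[P]_(w in A) (Y_ n w * g_ n w) - \int[P]_(w in A) (Y w * g_ n w)
    @[n --> \oo] --> 0.
  apply/cvgr0Pnorm_le => e e0.
  have /cvgr0Pnorm_le/(_ _ e0) := S; apply: filterS => n; apply: le_trans.
  rewrite -RintegralB //; [|exact: i_|exact: i_].
  apply: le_trans (le_normr_Rintegral mA _) _.
    exact: (integrableB mA (i_ _ n (mY_ n) (iY_ n)) (i_ _ n mY iY)).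
  rewrite ger0_norm ?Rintegral_ge0 //.
  have iD : P.-integrable setT (EFin \o (fun w => Y_ n w - Y w)).
    exact: (integrableB measurableT (iY_ n) iY).
  have iN : P.-integrable setT (EFin \o (fun w => `|Y_ n w - Y w|)).
    exact: (integrable_abse iD).
  apply: (@le_trans _ _ (\int[P]_(w in A) `|Y_ n w - Y w|)).
    apply: le_Rintegral => //.
    - exact: (integrable_abse
        (integrableB mA (i_ _ n (mY_ n) (iY_ n)) (i_ _ n mY iY))).
    - exact: iA iN.
    - by move=> w _; rewrite -mulrBl normrM ler_piMr.
  rewrite /Rintegral fine_le //.
  - exact: (integrable_fin_num mA (iA _ iN)).
  - exact: integrable_fin_num iN.
  by apply: ge0_subset_integral => //; exact: measurable_int iN.
have : (\int[P]_(w in A) (Y_ n w * g_ n w) - \int[P]_(w in A) (Y w * g_ n w)) +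
    \int[P]_(w in A) (Y w * g_ n w) @[n --> \oo] -->
    0 + \int[P]_(w in A) (Y w * g w) by exact: cvgD.
by rewrite add0r; under eq_fun do rewrite subrK.
Qed.

End LimitTheorems.

(** * The limit of the normalized process *)

Lemma coef_comp_scaleX (R : comNzRingType) (C : {poly R}) c k :
  (C \Po (c *: 'X))`_k = c ^+ k * C`_k.
Proof.
rewrite comp_polyE coef_sum.
under eq_bigr do rewrite exprZn !coefZ coefXn.
have [kC|Ck] := ltnP k (size C).
  rewrite (bigD1 (Ordinal kC)) //= eqxx mulr1 big1 ?addr0 1?mulrC // => i ik.
  by rewrite (_ : k == i = false) ?mulr0 //; apply/negbTE; rewrite eq_sym.
rewrite nth_default // mulr0 big1 // => i _.
rewrite (_ : k == i = false) ?mulr0 //; apply/negbTE.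
by rewrite neq_ltn (leq_trans (ltn_ord i) Ck) orbT.
Qed.

Lemma expRN_le_quadratic (R : realType) (x : R) :
  0 <= x -> expR (- x) <= 1 - x + x ^+ 2.
Proof.
move=> x0; rewrite expRN; have x1 : 0 < 1 + x by rewrite ltr_wpDr.
apply: (@le_trans _ _ (1 + x)^-1).
  by rewrite lef_pV2 ?posrE ?expR_gt0 // expR_ge1Dx.
rewrite -div1r ler_pdivrMr // -subr_ge0.
have -> : (1 - x + x ^+ 2) * (1 + x) - 1 = x ^+ 3 by ring.
exact: exprn_ge0.
Qed.

Lemma cvg_pow (R : realType) (u : nat -> R) (l : R) k :
  u n @[n --> \oo] --> l -> u n ^+ k @[n --> \oo] --> l ^+ k.
Proof.
move=> ul; elim: k => [|k IH]; first by rewrite expr0; exact: cvg_cst.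
by under eq_fun do rewrite exprS; rewrite exprS; exact: cvgM.
Qed.

Section MartingaleLimit.
Context d (T : measurableType d) (R : realType) (P : probability T R).
Variables (q : nat -> R) (Z : nat -> {RV P >-> nat}).
Variable xi : nat * nat -> {RV P >-> nat}.
Hypotheses (indep : mutually_independent xi)
  (law : forall i j, P (xi i @^-1` [set j]) = (q j)%:E)
  (Z0 : forall w, Z 0%N w = 1%N)
  (ZS : forall n w, Z n.+1 w = (\sum_(k < Z n w) xi (n, val k) w)%N).
Hypothesis q1 : (moment q 1 < +oo)%E.
Hypothesis mu_gt1 : 1 < mean q.

Let mu : R := mean q.
Let mu0 : 0 < mu := lt_trans ltr01 mu_gt1.

Definition normalized n w : R := (Z n w)%:R / mean q ^+ n.

Variable V : T -> R.
Hypotheses (mV : measurable_fun setT V) (V0 : forall w, 0 <= V w)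
  (Vlim : {ae P, forall w, normalized n w @[n --> \oo] --> V w}).

Let mpast n L : past_event Z n L -> measurable L.
Proof. exact: (measurable_past_event indep law Z0 ZS). Qed.

Lemma measurable_normalized n A : measurable_fun A (normalized n).
Proof. exact: (measurable_nat_fun _ (fun j => j%:R / mean q ^+ n)). Qed.

Lemma normalized_ge0 n w : 0 <= normalized n w.
Proof. by rewrite divr_ge0 // exprn_ge0 // ltW. Qed.

Lemma cvg_normalized_expR a :
  {ae P, forall w, expR (- (a * normalized n w)) @[n --> \oo] -->
    expR (- (a * V w))}.
Proof.
apply: filterS Vlim => w Vw; apply: continuous_cvg; first exact: continuous_expR.
by apply: cvgN; apply: cvgM => //; exact: cvg_cst.
Qed.

Lemma cvg_laplace A n a : measurable A -> 0 <= a ->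
  \int[P]_(w in A) expR (- (a * normalized (m + n) w)) @[m --> \oo] -->
  laplace_moment P V A 0 a.
Proof.
move=> mA a0; rewrite /laplace_moment.
under [X in _ --> X]eq_Rintegral do rewrite expr0 mul1r.
apply: Rintegral_dominated_cvg (finite_measure_integrable_cst P 1 mA) _ => //.
- move=> m; apply: measurableT_comp => //; apply: measurableT_comp => //.
  by apply: measurable_funM => //; exact: measurable_normalized.
- apply: (measurable_funS measurableT) => //.
  apply: measurableT_comp => //; apply: measurableT_comp => //.
  exact: measurable_funM.
- apply: filterS (cvg_normalized_expR a) => w Vw _.
  by rewrite -(cvg_shiftn n) in Vw.
- move=> m w _ /=; rewrite ger0_norm ?expR_ge0 // expRN_le1 //.
  by rewrite mulr_ge0 // normalized_ge0.
Qed.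

(** The branching property survives the limit: given Z_n = x, the variable V is
    distributed as the sum of x independent copies of itself, rescaled by
    mu^n. *)
Lemma laplace_fiber n L x a : past_event Z n L -> 0 <= a ->
  let A := L `&` Z n @^-1` [set x] in
  laplace_moment P V A 0 a =
  fine (P A) * laplace_moment P V setT 0 (a / mu ^+ n) ^+ x.
Proof.
move=> nL a0 A; have mA : measurable A := mpast (past_event_fiber (x := x) nL).
have b0 : 0 <= a / mu ^+ n by rewrite divr_ge0 // exprn_ge0 // ltW.
suff H : \int[P]_(w in A) expR (- (a * normalized (m + n) w)) @[m --> \oo] -->
    fine (P A) * laplace_moment P V setT 0 (a / mu ^+ n) ^+ x.
  exact: cvg_unique (cvg_laplace n mA a0) H.
have : fine (P A) * (\int[P]_w expR (- (a / mu ^+ n * normalized (m + 0) w))) ^+ x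
    @[m --> \oo] --> fine (P A) * laplace_moment P V setT 0 (a / mu ^+ n) ^+ x.
  apply: cvgM; first exact: cvg_cst.
  exact: cvg_pow (cvg_laplace 0 measurableT b0).
apply: cvg_trans; apply: near_eq_cvg; apply: nearW => m.
rewrite /= addn0; set s := expR (- (a / mu ^+ (m + n))).
have s01 : 0 <= s <= 1.
  by rewrite expR_ge0 expRN_le1 // divr_ge0 // exprn_ge0 // ltW.
have sE c k w : expR (- (c * normalized k w)) = expR (- (c / mu ^+ k)) ^+ Z k w.
  by rewrite -expRM_natr /normalized; congr expR; rewrite /mu; ring.
have := branching_pgf indep law Z0 ZS x m nL s01; rewrite -/A.
move=> /(congr1 fine); rewrite fineM ?fin_num_measure //= => H.
rewrite /Rintegral; under [X in _ = fine X]eq_integral do rewrite sE.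
rewrite H; congr (_ * _ ^+ _); apply: eq_Rintegral => w _.
by rewrite sE /s exprD invfM mulrA mulrAC.
Qed.

Section FiniteMoment.
Variable p : nat.
Hypotheses (p0 : (0 < p)%N) (qp : (moment q p < +oo)%E).

Lemma normalized_power_bound : exists2 B : R, 0 <= B & forall n,
  (\int[P]_w (normalized n w ^+ p)%:E <= B%:E)%E.
Proof.
have [B B0 HB] := integral_power_bound indep law Z0 ZS q1 mu_gt1 p0 qp.
exists B => // n.
have c0 : 0 <= (mu ^+ (p * n))^-1 by rewrite invr_ge0 exprn_ge0 // ltW.
have -> : (\int[P]_w (normalized n w ^+ p)%:E =
    (mu ^+ (p * n))^-1%:E * \int[P]_w ((Z n w)%:R ^+ p)%:E)%E.
  have mZ : measurable_fun setT (fun w => ((Z n w)%:R ^+ p : R)%:E).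
    by apply/measurable_EFinP; exact: (measurable_nat_fun _ (fun j => j%:R ^+ p)).
  rewrite -(ge0_integralZl_EFin _ measurableT _ mZ c0); last first.
    by move=> w _; rewrite lee_fin exprn_ge0.
  apply: eq_integral => w _.
  by rewrite -EFinM /normalized expr_div_n -exprM mulnC mulrC.
apply: le_trans (lee_wpmul2l _ (HB n)) _; first by rewrite lee_fin.
by rewrite -EFinM lee_fin mulrCA mulVf ?mulr1 // expf_neq0 // gt_eqF.
Qed.

Lemma integrable_limit_power : P.-integrable setT (fun w => (V w ^+ p)%:E).
Proof.
have [B B0 HB] := normalized_power_bound.
apply/integrableP; split.
  by apply/measurable_EFinP; exact: measurable_funX.
under eq_integral do rewrite gee0_abs ?lee_fin ?exprn_ge0 //.
apply: (@le_lt_trans _ _ B%:E); last exact: ltry.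
apply: (@fatou_bound _ _ _ P (fun n w => normalized n w ^+ p)) => //.
- by move=> n; apply: measurable_funX; exact: measurable_normalized.
- exact: measurable_funX.
- by move=> n w; rewrite exprn_ge0 // normalized_ge0.
- by move=> w; rewrite exprn_ge0.
- by apply: filterS Vlim => w Vw; exact: cvg_pow.
Qed.

Definition limit_jet a : {poly R} := laplace_jet P V setT p a.

Lemma limit_jet_ge0 a k : 0 <= (limit_jet a)`_k.
Proof.
rewrite coef_poly; case: ifP => // _; rewrite divr_ge0 //.
exact: laplace_moment_ge0.
Qed.

Lemma limit_jet0 : (limit_jet 0)`_0 = 1.
Proof.
rewrite coef_poly /= /laplace_moment fact0 divr1.
under eq_Rintegral do rewrite expr0 mul0r oppr0 expR0 mulr1.
by rewrite Rintegral_cst //= mul1r probability_setT.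
Qed.

(** Taking p derivatives of laplace_fiber; the rescaled variable V / mu^n
    accounts for the factor mu^(p n). *)
Lemma laplace_moment_fiber n L x a : past_event Z n L -> 0 <= a ->
  let A := L `&` Z n @^-1` [set x] in
  laplace_moment P V A p a =
  fine (P A) * (p`!%:R / mu ^+ (p * n) * (limit_jet (a / mu ^+ n) ^+ x)`_p).
Proof.
move=> nL a0 A; have mA : measurable A := mpast (past_event_fiber (x := x) nL).
pose c : R := (mu ^+ n)^-1; have c0 : 0 <= c by rewrite invr_ge0 exprn_ge0 // ltW.
pose V' w := c * V w.
have mV' : measurable_fun setT V' by exact: measurable_funM.
have V'0 w : 0 <= V' w by rewrite mulr_ge0.
have iV := integrable_limit_power.
have iV' : P.-integrable setT (fun w => (V' w ^+ p)%:E).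
  have := integrableZl measurableT (c ^+ p) iV; apply: eq_integrable => // w _.
  by rewrite -EFinM exprMn.
have iA : P.-integrable A (fun w => (V w ^+ p)%:E) by apply: integrableS iV.
have scale k b : (k <= p)%N -> 0 <= b ->
    laplace_moment P V' setT k b = c ^+ k * laplace_moment P V setT k (b * c).
  move=> kp b0; rewrite /laplace_moment -RintegralZl //.
    by apply: eq_Rintegral => w _; rewrite /V' exprMn !mulrA.
  by apply: (integrable_laplace mV V0 measurableT iV) => //; exact: mulr_ge0.
have law0 b : 0 <= b -> laplace_moment P V A 0 b =
    fine (P A) * laplace_moment P V' setT 0 b ^+ x.
  by move=> b0; rewrite scale // expr0 mul1r laplace_fiber.
have := laplace_jet_power mV V0 mA iA mV' V'0 iV' law0 (leqnn p) a0.
have -> : laplace_jet P V' setT p a = limit_jet (a / mu ^+ n) \Po (c *: 'X).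
  apply/polyP => k; rewrite coef_comp_scaleX !coef_poly; case: ltnP => // kp.
    by rewrite scale // mulrA.
  by rewrite mulr0.
rewrite -comp_Xn_poly comp_polyA comp_Xn_poly coef_comp_scaleX.
rewrite coef_poly ltnS leqnn => /(congr1 (fun r => r * p`!%:R)).
rewrite divfK ?pnatr_eq0 -?lt0n ?fact_gt0 // => ->.
rewrite /c exprVn -exprM mulnC; ring.
Qed.

Lemma integrable_limit_laplace A a : measurable A -> 0 <= a ->
  P.-integrable A (EFin \o (fun w => V w ^+ p * expR (- (a * V w)))).
Proof.
move=> mA a0; apply: (integrable_laplace mV V0 mA _ (leqnn p) a0).
exact: integrableS integrable_limit_power.
Qed.

Lemma laplace_moment_fibers L n a : measurable L -> 0 <= a ->
  (laplace_moment P V L p a)%:E =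
  (\sum_(x <oo) (laplace_moment P V (L `&` Z n @^-1` [set x]) p a)%:E)%E.
Proof.
move=> mL a0; rewrite /laplace_moment /Rintegral fineK; last first.
  exact: integrable_fin_num (integrable_limit_laplace mL a0).
rewrite (integral_fibers (Z n) mL); last 2 first.
- by apply/measurable_EFinP; exact: measurable_laplace.
- by move=> w _; rewrite lee_fin laplace_integrand_ge0.
apply: eq_eseriesr => x _; rewrite fineK //.
have mLx := measurable_fiber (Z n) mL x.
exact: integrable_fin_num (integrable_limit_laplace mLx a0).
Qed.

(** p! H_p(Z_n) / mu^(p n): falling powers replace powers because their moments
    are exactly the leading terms in the branching formula. *)
Definition falling_normalized n w : R :=
  p`!%:R * 'C(Z n w, p)%:R / mean q ^+ (p * n).

Lemma falling_normalized_ge0 n w : 0 <= falling_normalized n w.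
Proof. by rewrite divr_ge0 ?mulr_ge0 // exprn_ge0 // ltW. Qed.

Lemma measurable_falling_normalized n A :
  measurable_fun A (falling_normalized n).
Proof.
exact: (measurable_nat_fun _
  (fun j => p`!%:R * 'C(j, p)%:R / mean q ^+ (p * n))).
Qed.

Lemma cvg_falling_normalized :
  {ae P, forall w, falling_normalized n w @[n --> \oo] --> V w ^+ p}.
Proof.
apply: filterS Vlim => w Vw.
suff H k : (Z n w ^_ k)%:R / mu ^+ (k * n) @[n --> \oo] --> V w ^+ k.
  rewrite /falling_normalized; under eq_fun do rewrite -natrM mulnC bin_ffact.
  exact: H.
elim: k => [|k IH].
  under eq_fun do rewrite ffactn0 mul0n expr0 divr1.
  by rewrite expr0; exact: cvg_cst.
have mu0n n : mu ^+ n != 0 by rewrite expf_neq0 // gt_eqF.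
have E n : (Z n w ^_ k.+1)%:R / mu ^+ (k.+1 * n) =
    (Z n w ^_ k)%:R / mu ^+ (k * n) * (normalized n w - k%:R * mu^-1 ^+ n).
  rewrite natr_ffactS /normalized -/mu mulSn exprD exprVn invfM; ring.
under eq_fun do rewrite E.
rewrite exprSr; apply: cvgM => //.
have mu1 : `|mu^-1| < 1 by rewrite ger0_norm ?invr_ge0 ?(ltW mu0) // invf_lt1.
have : normalized n w - k%:R * mu^-1 ^+ n @[n --> \oo] --> V w - k%:R * 0.
  by apply: cvgB => //; apply: cvgM; [exact: cvg_cst|exact: cvg_expr].
by rewrite mulr0 subr0.
Qed.

(** At a = 0 the term i = p of laplace_moment_fiber is
    p! H_p(x) (E V)^p / mu^(p n). This plays the role of the conditional Jensen inequality for V^p. *)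
Lemma integral_falling_le n : 1 <= \int[P]_w V w ->
  (\int[P]_w (falling_normalized n w)%:E <= \int[P]_w (V w ^+ p)%:E)%E.
Proof.
move=> V1.
have -> : (\int[P]_w (V w ^+ p)%:E = (laplace_moment P V setT p 0)%:E)%E.
  rewrite /laplace_moment /Rintegral fineK; last first.
    exact: integrable_fin_num (integrable_limit_laplace measurableT (lexx 0)).
  by apply: eq_integral => w _; rewrite mul0r oppr0 expR0 mulr1.
rewrite (laplace_moment_fibers n measurableT (lexx 0)).
rewrite (integral_fibers (Z n) measurableT); last 2 first.
- by apply/measurable_EFinP; exact: measurable_falling_normalized.
- by move=> w _; rewrite lee_fin falling_normalized_ge0.
apply: lee_nneseries => [x _ _|x _].
  by apply: integral_ge0 => w _; rewrite lee_fin falling_normalized_ge0.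
have nT : past_event Z n setT by [].
rewrite (laplace_moment_fiber x nT (lexx 0)); set A := setT `&` _.
have mA : measurable A by exact: measurable_fiber.
have -> : (\int[P]_(w in A) (falling_normalized n w)%:E =
    (p`!%:R * 'C(x, p)%:R / mean q ^+ (p * n))%:E * P A)%E.
  rewrite -integral_cst //.
  by apply: eq_integral => w /[!inE] -[_ /= Zx]; rewrite /falling_normalized Zx.
rewrite -[P A]fineK ?fin_num_measure // -EFinM lee_fin mulrC ler_wpM2l ?fine_ge0 //.
rewrite mulrAC ler_wpM2l ?divr_ge0 ?exprn_ge0 ?(ltW mu0) // mul0r.
apply: le_trans (coef_exp_ge_leading (limit_jet_ge0 0) p x).
rewrite limit_jet0.
have -> : (limit_jet 0)`_1 = \int[P]_w V w.
  rewrite coef_poly ltnS p0 /laplace_moment factS fact0 muln1 mulr1n divr1.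
  by apply: eq_Rintegral => w _; rewrite mul0r oppr0 expR0 mulr1 expr1.
by rewrite expr1n mulr1 ler_peMr // exprn_ege1.
Qed.

End FiniteMoment.

(** A second moment makes the martingale uniformly integrable. On Laplace
    transforms this is the bound 1 - b + B b^2, uniform in n, for b near 0. *)
Lemma mean_limit_ge1 : (moment q 2 < +oo)%E -> 1 <= \int[P]_w V w.
Proof.
move=> q2; have [B B0 HB] := normalized_power_bound (ltn0Sn 1) q2.
have iV : P.-integrable setT (EFin \o V).
  exact: (integrable_limit_power (ltn0Sn 0) q1).
have mW k n : measurable_fun setT (fun w => normalized n w ^+ k).
  by apply: measurable_funX; exact: measurable_normalized.
have iW2 n : P.-integrable setT (EFin \o (fun w => normalized n w ^+ 2)).
  apply/integrableP; split; first exact/measurable_EFinP.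
  under eq_integral do rewrite gee0_abs ?lee_fin ?exprn_ge0 ?normalized_ge0 //.
  exact: le_lt_trans (HB n) (ltry _).
have iW n : P.-integrable setT (EFin \o normalized n).
  have := integrable_power (measurable_normalized n (A := setT)) (normalized_ge0 n)
    measurableT (iW2 n) (isT : (1 <= 2)%N).
  by apply: eq_integrable => // w _ /=; rewrite expr1.
have EW n : \int[P]_w normalized n w = 1.
  rewrite /Rintegral.
  have mZ : measurable_fun setT (fun w => (Z n w)%:R%:E : \bar R).
    by apply/measurable_EFinP; exact: (measurable_nat_fun _ (fun j => j%:R)).
  have c0 : 0 <= (mu ^+ n)^-1 by rewrite invr_ge0 exprn_ge0 // ltW.
  have -> : (\int[P]_w (normalized n w)%:E =
      \int[P]_w ((mu ^+ n)^-1%:E * (Z n w)%:R%:E))%E.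
    by apply: eq_integral => w _; rewrite -EFinM mulrC.
  rewrite (ge0_integralZl_EFin _ measurableT _ mZ c0); last first.
    by move=> w _; rewrite lee_fin.
  rewrite (integral_mean indep law Z0 ZS q1 mu_gt1) -EFinM /= mulVf //.
  by rewrite expf_neq0 // gt_eqF.
have i1 : P.-integrable setT (EFin \o cst (1 : R)).
  exact: finite_measure_integrable_cst.
have E1 : \int[P]_w (cst 1 w : R) = 1.
  by rewrite Rintegral_cst //= mul1r probability_setT.
have bound b : 0 < b -> 1 - b * \int[P]_w V w <= 1 - b + b ^+ 2 * B.
  move=> b0; have ibV : P.-integrable setT (EFin \o (fun w => b * V w)).
    exact: (integrableZl measurableT b iV).
  apply: (@le_trans _ _ (laplace_moment P V setT 0 b)).
    have -> : 1 - b * \int[P]_w V w = \int[P]_w (cst 1 w - b * V w).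
      by rewrite RintegralB // RintegralZl // E1.
    apply: le_Rintegral => //.
    - exact: (integrableB measurableT i1 ibV).
    - have iV0 : P.-integrable setT (fun w => (V w ^+ 0)%:E).
        by apply: eq_integrable i1 => // w _; rewrite expr0.
      exact: (integrable_laplace mV V0 measurableT iV0 (leqnn 0) (ltW b0)).
    - by move=> w _; rewrite expr0 mul1r /= (le_trans _ (expR_ge1Dx _)).
  apply: (ler_cvg_to (cvg_laplace 0 measurableT (ltW b0))
    (cvg_cst (1 - b + b ^+ 2 * B))); apply: nearW => m; rewrite addn0.
  have ibW : P.-integrable setT (EFin \o (fun w => b * normalized m w)).
    exact: (integrableZl measurableT b (iW m)).
  have ibW2 : P.-integrable setT
      (EFin \o (fun w => b ^+ 2 * normalized m w ^+ 2)).
    exact: (integrableZl measurableT (b ^+ 2) (iW2 m)).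
  have i1W : P.-integrable setT (EFin \o (fun w => cst 1 w - b * normalized m w)).
    exact: (integrableB measurableT i1 ibW).
  apply: (@le_trans _ _ (\int[P]_w ((cst 1 w - b * normalized m w) +
      b ^+ 2 * normalized m w ^+ 2))).
    apply: le_Rintegral => //.
    - apply: (le_integrable measurableT _ _ i1).
        apply/measurable_EFinP; apply: measurableT_comp => //.
        apply: measurableT_comp => //; apply: measurable_funM => //.
        exact: measurable_normalized.
      move=> w _ /=; rewrite lee_fin normr1 ger0_norm ?expR_ge0 //.
      by rewrite expRN_le1 // mulr_ge0 ?normalized_ge0 // ltW.
    - exact: (integrableD measurableT i1W ibW2).
    - move=> w _ /=; rewrite -exprMn expRN_le_quadratic //.
      by rewrite mulr_ge0 ?normalized_ge0 // ltW.
  rewrite RintegralD // RintegralB // !RintegralZl // E1 EW mulr1 lerD2l.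
  rewrite ler_wpM2l ?exprn_ge0 ?(ltW b0) //.
  rewrite -lee_fin /Rintegral fineK ?HB //.
  exact: integrable_fin_num (iW2 m).
apply/ler_addgt0Pr => e e0.
have B1 : 0 < B + 1 by rewrite ltr_wpDl.
have b0 : 0 < e / (B + 1) by rewrite divr_gt0.
have := bound _ b0; set b := e / (B + 1) in b0 *.
rewrite -addrA lerD2l -[leLHS]mulrN -[- b + _]/(_ + _) expr2 -mulrA.
rewrite -[X in X + _ ](mulrN1 b) -mulrDr ler_pM2l // => h.
have be : b * B <= e.
  rewrite /b mulrAC ler_pdivrMr // ler_wpM2l ?(ltW e0) //.
  by rewrite lerDl.
lra.
Qed.

End MartingaleLimit.

(** * Limits of the weighted expectations *)

Lemma expectation_indic_mul d (T : measurableType d) (R : realType)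
    (P : probability T R) (f : T -> R) (L : set T) :
  ('E_P[fun w => (f w * \1_L w)%R] = \int[P]_(w in L) (f w)%:E)%E.
Proof.
rewrite unlock [RHS]integral_mkcond; apply: eq_integral => w _.
by rewrite patchE indicE; case: ifP => _; rewrite /= ?mulr1 ?mulr0.
Qed.

Lemma fine_mulr (R : realType) (c : R) (x : \bar R) : 0 < c -> (0 <= x)%E ->
  fine (c%:E * x) = c * fine x.
Proof. by move=> c0; case: x => // _; rewrite gt0_muley ?lte_fin //= mulr0. Qed.

Section Conclusion.
Context d (T : measurableType d) (R : realType) (P : probability T R).
Variables (q : nat -> R) (Z : nat -> {RV P >-> nat}).
Variable xi : nat * nat -> {RV P >-> nat}.
Hypotheses (indep : mutually_independent xi)
  (law : forall i j, P (xi i @^-1` [set j]) = (q j)%:E)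
  (Z0 : forall w, Z 0%N w = 1%N)
  (ZS : forall n w, Z n.+1 w = (\sum_(k < Z n w) xi (n, val k) w)%N).
Hypothesis q1 : (moment q 1 < +oo)%E.
Hypothesis mu_gt1 : 1 < mean q.

Let mu : R := mean q.
Let mu0 : 0 < mu := lt_trans ltr01 mu_gt1.

Variable V : T -> R.
Hypotheses (mV : measurable_fun setT V) (V0 : forall w, 0 <= V w)
  (Vlim : {ae P, forall w, normalized q Z n w @[n --> \oo] --> V w}).
Variable p : nat.
Hypotheses (p0 : (0 < p)%N) (qp : (moment q p < +oo)%E).
Variable a : R.
Hypothesis a0 : 0 <= a.

Let phi : R -> R := laplace_moment P V setT 0.
Let iV := integrable_limit_power indep law Z0 ZS q1 mu_gt1 mV V0 Vlim p0 qp.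
Let J b := limit_jet P V p b.

Lemma halfline_deriven_jet k b : (k <= p)%N -> 0 <= b ->
  halfline_deriven k phi b = (- 1) ^+ k * (k`!%:R * (J b)`_k).
Proof.
move=> kp b0; rewrite (halfline_deriven_laplace mV V0 measurableT iV kp b0).
by rewrite coef_poly ltnS kp [k`!%:R * _]mulrC divfK //.
Qed.

Lemma acoef_jet i n : (i <= p)%N ->
  acoef phi mu a p i n =
  (- 1) ^+ p * (drop_poly 1 (J (a / mu ^+ n)) ^+ i)`_(p - i).
Proof.
move=> ip; have b0 : 0 <= a / mu ^+ n by rewrite divr_ge0 // exprn_ge0 // ltW.
rewrite coef_exp_compositions ?size_poly // mulr_sumr; apply: eq_bigr => s.
rewrite inE => /andP[_ /eqP sp].
transitivity (\prod_(r < i) ((- 1) ^+ s r * (J (a / mu ^+ n))`_(s r))).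
  apply: eq_bigr => r _; rewrite halfline_deriven_jet ?leq_ord //.
  by rewrite -mulrA; congr (_ * _); rewrite mulrAC divff ?mul1r //.
by rewrite big_split /= prodrXr sp.
Qed.

(** The sum over compositions in the limit law is coefficient p of the x-th power
    of the jet of phi. The signs (-1)^p of the numerator and of phi^(p)(a)
    cancel. *)
Lemma Gfun_jet n x :
  Gfun phi mu a p n x = (J (a / mu ^+ n) ^+ x)`_p / (J a)`_p.
Proof.
have b0 : 0 <= a / mu ^+ n by rewrite divr_ge0 // exprn_ge0 // ltW.
have f0 : p`!%:R != 0 :> R by rewrite pnatr_eq0 -lt0n fact_gt0.
rewrite /Gfun halfline_deriven_jet // big_add1 big_mkord.
rewrite [in RHS]coef_exp_split big_ord_recl /= expr0 !subn0 coef1.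
rewrite (gtn_eqF p0) mulr0 add0r.
have sgn : ((- 1) ^+ p : R)^-1 * (- 1) ^+ p = 1 by rewrite mulVf // signr_eq0.
transitivity ((((- 1) ^+ p)^-1 * ((J a)`_p)^-1) * \sum_(i < p) ((- 1) ^+ p *
    ('C(x, i.+1)%:R * (J (a / mu ^+ n))`_0 ^+ (x - i.+1) *
     (drop_poly 1 (J (a / mu ^+ n)) ^+ i.+1)`_(p - i.+1)))).
  congr (_ * _); first by rewrite !invfM mulrCA mulVKf.
  apply: eq_bigr => i _; rewrite acoef_jet // horner_Hpoly -!mulrA; congr (_ * _).
  have [ix|xi'] := leqP i.+1 x; last by rewrite bin_small // !(mul0r, mulr0).
  have -> : phi (a / mu ^+ n) = (J (a / mu ^+ n))`_0.
    by rewrite coef_poly /= fact0 divr1.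
  by rewrite subzn // -exprnP; ring.
by rewrite -mulr_sumr mulrACA sgn mul1r mulrC.
Qed.

Let LM A := laplace_moment P V A p a.

Lemma coef_jet_top : (J a)`_p = LM setT / p`!%:R.
Proof. by rewrite coef_poly ltnS leqnn. Qed.

(** Both sides are sums over the values of Z_n, and laplace_moment_fiber
    identifies them term by term; the function Gfun is nonnegative, which
    permits the exchange of sum and integral. *)
Lemma expectation_Gfun n L : past_event Z n L -> LM setT != 0 ->
  fine 'E_P[fun w => (mu ^+ (p * n))^-1 * Gfun phi mu a p n (Z n w) * \1_L w] =
  LM L / LM setT.
Proof.
move=> nL LMT; rewrite expectation_indic_mul.
have mL := measurable_past_event indep law Z0 ZS nL.
have LM0 : 0 < LM setT by rewrite lt_neqAle eq_sym LMT laplace_moment_ge0.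
pose g x := (mu ^+ (p * n))^-1 * Gfun phi mu a p n x.
have g0 x : 0 <= g x.
  rewrite mulr_ge0 ?invr_ge0 ?exprn_ge0 ?(ltW mu0) // Gfun_jet.
  rewrite divr_ge0 //; last exact: limit_jet_ge0.
  by apply: coef_exp_ge0 => k; exact: limit_jet_ge0.
rewrite -[RHS]/(fine (LM L / LM setT)%:E); congr fine.
rewrite (integral_fibers (Z n) mL); last 2 first.
- by apply/measurable_EFinP; exact: (measurable_nat_fun _ g).
- by move=> w _; rewrite lee_fin; exact: g0.
rewrite mulrC EFinM (laplace_moment_fibers indep law Z0 ZS q1 mu_gt1 mV V0 Vlim
  p0 qp n mL a0) -nneseriesZl; last first.
  by move=> x _; rewrite lee_fin laplace_moment_ge0.
apply: eq_eseriesr => x _.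
transitivity (\int[P]_(w in L `&` Z n @^-1` [set x]) (g x)%:E)%E.
  by apply: eq_integral => w /[!inE] -[_ /= ->].
have mLx := measurable_fiber (Z n) mL x.
rewrite integral_cst // -[X in (_ * X)%E = _]fineK ?fin_num_measure //.
rewrite (laplace_moment_fiber indep law Z0 ZS q1 mu_gt1 mV V0 Vlim p0 qp x nL a0).
rewrite -!EFinM; congr EFin.
rewrite /= /g Gfun_jet coef_jet_top /J -/mu invf_div; ring.
Qed.

Let I A n := \int[P]_(w in A) (falling_normalized q Z p n w *
  expR (- (a * normalized q Z n w))).

Lemma expectation_Hpoly n L : measurable L ->
  fine 'E_P[fun w => (Hpoly R p).[(Z n w)%:R]
                     * expR (- (a * (Z n w)%:R / mu ^+ n)) * \1_L w] =
  mu ^+ (p * n) / p`!%:R * I L n.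
Proof.
move=> mL; rewrite expectation_indic_mul.
have c0 : 0 < mu ^+ (p * n) / p`!%:R.
  by rewrite divr_gt0 ?exprn_gt0 // ltr0n fact_gt0.
have mf : measurable_fun L (fun w => (falling_normalized q Z p n w *
    expR (- (a * normalized q Z n w)))%:E).
  apply/measurable_EFinP; exact: (measurable_nat_fun _ (fun j =>
    p`!%:R * 'C(j, p)%:R / mu ^+ (p * n) * expR (- (a * (j%:R / mu ^+ n))))).
have f0 w : 0 <= falling_normalized q Z p n w * expR (- (a * normalized q Z n w)).
  by rewrite mulr_ge0 ?expR_ge0 // falling_normalized_ge0.
rewrite /I /Rintegral -fine_mulr //; last first.
  by apply: integral_ge0 => w _; rewrite lee_fin.
rewrite -(ge0_integralZl_EFin _ mL _ mf (ltW c0)); last first.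
  by move=> w _; rewrite lee_fin.
congr fine; apply: eq_integral => w _; rewrite -EFinM; congr EFin.
rewrite horner_Hpoly /normalized /falling_normalized mulrA -[a * _ / _]mulrA.
congr (_ * _); rewrite -/mu.
have f0' : p`!%:R != 0 :> R by rewrite pnatr_eq0 -lt0n fact_gt0.
have m0 : mu ^+ (p * n) != 0 by rewrite expf_neq0 // gt_eqF.
by field; rewrite m0.
Qed.

Lemma expectation_Hpoly_total n :
  fine 'E_P[fun w => (Hpoly R p).[(Z n w)%:R]
                     * expR (- (a * (Z n w)%:R / mu ^+ n))] =
  mu ^+ (p * n) / p`!%:R * I setT n.
Proof.
rewrite -expectation_Hpoly //; congr (fine 'E_P[_]%E); apply/funext => w.
by rewrite indicT mulr1.
Qed.

(** For p >= 2 the falling powers converge in mean. For p = 1 and a > 0 the weight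
    bounds the integrand, as x exp (- a x) <= 1 / a. *)
Lemma cvg_weighted_falling A : measurable A -> (2 <= p)%N || (0 < a) ->
  I A n @[n --> \oo] --> LM A.
Proof.
move=> mA; case: (leqP 2 p) => /= [p2 _|p1 apos].
  apply: scheffe_weighted => //.
  - by move=> n; exact: measurable_falling_normalized.
  - exact: measurable_funX.
  - move=> n; exact: (measurable_nat_fun _ (fun j => expR (- (a * (j%:R / mu ^+ n))))).
  - apply: measurableT_comp => //; apply: measurableT_comp => //.
    exact: measurable_funM.
  - by move=> n w; exact: falling_normalized_ge0.
  - by move=> w; rewrite exprn_ge0.
  - move=> n w; rewrite expR_ge0 expRN_le1 // mulr_ge0 //.
    exact: normalized_ge0.
  - exact: cvg_falling_normalized.
  - exact: cvg_normalized_expR.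
  - move=> n; apply: (integral_falling_le indep law Z0 ZS q1 mu_gt1 mV V0 Vlim p0 qp).
    apply: (mean_limit_ge1 indep law Z0 ZS q1 mu_gt1 mV V0 Vlim).
    exact: (moment_le law p2 qp).
have p1' : p = 1%N by apply/eqP; rewrite eqn_leq p0 -ltnS p1.
apply: (Rintegral_dominated_cvg (g := cst a^-1)) => //.
- move=> n; exact: (measurable_nat_fun _ (fun j =>
    p`!%:R * 'C(j, p)%:R / mu ^+ (p * n) * expR (- (a * (j%:R / mu ^+ n))))).
- exact: measurable_laplace.
- have := cvg_falling_normalized mu_gt1 Vlim p.
  have := cvg_normalized_expR Vlim a.
  by apply: filterS2 => w gw Yw _; exact: cvgM.
- exact: finite_measure_integrable_cst.
- move=> n w _; rewrite ger0_norm; last first.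
    by rewrite mulr_ge0 ?expR_ge0 // falling_normalized_ge0.
  rewrite /falling_normalized p1' bin1 mul1n factS fact0 muln1 mulr1n mul1r /=.
  rewrite -/(normalized q Z n w) expRN ler_pdivrMr ?expR_gt0 //.
  rewrite ler_pdivlMl // (le_trans _ (expR_ge1Dx _)) // lerDr //.
Qed.

(** With a finite first moment alone Z_n / mu^n need not converge in mean to V,
    but by the martingale property the integrals over A are constant from
    generation n on, and laplace_moment_fiber shows that they are proportional
    to those of V. *)
Lemma mean_proportional n A m : p = 1%N -> a = 0 -> past_event Z n A ->
  LM setT != 0 -> LM A = LM setT * I A (m + n)%N.
Proof.
move=> hp ha nA LMT.
have LM0 : 0 < LM setT by rewrite lt_neqAle eq_sym LMT laplace_moment_ge0.
have mA := measurable_past_event indep law Z0 ZS nA.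
have mN k : measurable_fun A (fun w => (normalized q Z k w)%:E).
  by apply/measurable_EFinP; exact: measurable_normalized.
have N0 k w : (0 <= (normalized q Z k w)%:E)%E by rewrite lee_fin normalized_ge0.
have -> : I A (m + n)%N = fine (\int[P]_(w in A) (normalized q Z n w)%:E)%E.
  rewrite /I /Rintegral; congr fine.
  have mZ k : measurable_fun A (fun w => (Z k w)%:R%:E : \bar R).
    by apply/measurable_EFinP; exact: (measurable_nat_fun _ (fun j => j%:R)).
  have Z0' k w : (0 <= (Z k w)%:R%:E :> \bar R)%E by rewrite lee_fin.
  have c0 k : 0 <= (mu ^+ k)^-1 by rewrite invr_ge0 exprn_ge0 // ltW.
  transitivity ((mu ^+ (m + n))^-1%:E * \int[P]_(w in A) (Z (m + n)%N w)%:R%:E)%E.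
    rewrite -(ge0_integralZl_EFin _ mA (fun w _ => Z0' _ w) (mZ _) (c0 _)).
    apply: eq_integral => w _; rewrite -EFinM; congr EFin.
    rewrite ha mul0r oppr0 expR0 mulr1 /falling_normalized hp bin1 mul1n.
    by rewrite factS fact0 muln1 mulr1n mul1r mulrC.
  rewrite (integral_mean_iter indep law Z0 ZS q1 mu_gt1 _ nA) muleA -EFinM.
  rewrite exprD invfM mulrAC mulVf ?mul1r ?expf_neq0 ?gt_eqF //.
  rewrite -(ge0_integralZl_EFin _ mA (fun w _ => Z0' _ w) (mZ _) (c0 _)).
  by apply: eq_integral => w _; rewrite -EFinM mulrC.
rewrite -fine_mulr //; last by apply: integral_ge0 => w _; exact: N0.
rewrite -[LHS]/(fine (LM A)%:E); congr fine.
rewrite (laplace_moment_fibers indep law Z0 ZS q1 mu_gt1 mV V0 Vlim p0 qp n mA a0).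
rewrite (integral_fibers (Z n) mA (mN n)) // -nneseriesZl; last first.
  by move=> x _; apply: integral_ge0 => w _; exact: N0.
apply: eq_eseriesr => x _; have mAx := measurable_fiber (Z n) mA x.
rewrite (laplace_moment_fiber indep law Z0 ZS q1 mu_gt1 mV V0 Vlim p0 qp x nA a0).
transitivity ((LM setT)%:E * \int[P]_(w in A `&` Z n @^-1` [set x])
  (x%:R / mu ^+ n)%:E)%E; last first.
  by congr (_ * _)%E; apply: eq_integral => w /[!inE] -[_ /= Zx];
     rewrite /normalized Zx.
rewrite integral_cst // -[X in (_ * (_ * X))%E]fineK ?fin_num_measure //.
rewrite -!EFinM; congr EFin.
have := coef_jet_top; rewrite ha mul0r -/(J 0) hp => J1.
rewrite coef1_exp; last exact: limit_jet0.
rewrite J1 factS fact0 muln1 mulr1n divr1 mul1n -mulr_natr -/mu; ring.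
Qed.

(** For p >= 2 the limit has mean at least 1 and cannot vanish almost surely. *)
Lemma limit_moment_neq0 : (p = 1%N -> halfline_deriven 1 phi a != 0) ->
  LM setT != 0.
Proof.
move=> phi1; case: (leqP 2 p) => [p2|p1].
  apply/eqP => LM0.
  have V1 := mean_limit_ge1 indep law Z0 ZS q1 mu_gt1 mV V0 Vlim
    (moment_le law p2 qp).
  have iL := integrable_limit_laplace indep law Z0 ZS q1 mu_gt1 mV V0 Vlim p0 qp
    measurableT a0.
  have I0 : (\int[P]_w `|(V w ^+ p * expR (- (a * V w)))%:E| = 0)%E.
    under eq_integral do rewrite gee0_abs ?lee_fin ?laplace_integrand_ge0 //.
    transitivity (LM setT)%:E; last by rewrite LM0.
    rewrite /LM /laplace_moment /Rintegral fineK //.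
    exact: (integrable_fin_num measurableT iL).
  have V_ae : ae_eq P setT (EFin \o V) (cst 0%E).
    have /ae_eq_integral_abs : measurable_fun setT
        (EFin \o (fun w => V w ^+ p * expR (- (a * V w)))).
      by apply/measurable_EFinP; exact: measurable_laplace.
    move=> /(_ P measurableT) [/(_ I0) H _].
    apply: filterS H => w /(_ Logic.I) [] /eqP.
    rewrite mulf_eq0 (gt_eqF (expR_gt0 _)) orbF expf_eq0 p0 => /eqP Vw _ /=.
    by rewrite Vw.
  have V00 : \int[P]_w V w = 0.
    rewrite /Rintegral (ae_eq_integral _ _ _ _ _ V_ae) //.
      by rewrite integral_cst //= mul0e.
    exact/measurable_EFinP.
  by move: V1; rewrite V00 ler10.
have p1' : p = 1%N by apply/eqP; rewrite eqn_leq p0 -ltnS p1.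
have := phi1 p1'; rewrite halfline_deriven_jet // expr1 mulN1r oppr_eq0.
apply: contraNneq => LM0; rewrite -{2}p1'.
by rewrite [(J a)`_p]coef_jet_top LM0 mul0r mulr0.
Qed.

(** When p = 1 and a = 0 the ratio is constant in m. *)
Lemma cvg_ratio n L : past_event Z n L -> LM setT != 0 ->
  I L (m + n)%N / I setT (m + n)%N @[m --> \oo] --> LM L / LM setT.
Proof.
move=> nL LMT; have mL := measurable_past_event indep law Z0 ZS nL.
case: (boolP ((2 <= p)%N || (0 < a))) => [pa|].
  have shift A : measurable A -> I A (m + n)%N @[m --> \oo] --> LM A.
    move=> mA; have H := cvg_weighted_falling mA pa.
    by rewrite -(cvg_shiftn n) in H.
  by apply: cvgM; [exact: shift|apply: cvgV => //; exact: shift].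
rewrite negb_or -ltnNge -leNgt => /andP[p1 ale0].
have hp : p = 1%N by apply/eqP; rewrite eqn_leq p0 -ltnS p1.
have ha : a = 0 by apply/eqP; rewrite eq_le ale0 a0.
have nT : past_event Z n setT by [].
under eq_fun => m.
  have -> : I L (m + n)%N / I setT (m + n)%N = LM L / LM setT.
    rewrite (mean_proportional m hp ha nL LMT).
    rewrite [in X in _ = _ / X](mean_proportional m hp ha nT LMT).
    by rewrite -mulf_div divff ?mul1r.
  over.
exact: cvg_cst.
Qed.

End Conclusion.

(** * The limit theorem *)

(* The hypothesis on [halfline_deriven 1 phi a] is needed for the right-hand
   side to make sense when p = 1: a finite mean alone allows W = 0 a.s., in
   which case phi = 1 and the quotient by phi^(1)(a) is undefined. *)
Theorem theorem4p2 (R : realType) (d : measure_display) (T : measurableType d)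
    (P : probability T R) (q : nat -> R) (Z : nat -> {RV P >-> nat})
    (W : {RV P >-> R}) (p : nat) :
  (1 <= p)%N ->
  offspring_distribution q ->
  1 < mean q ->
  (moment q p < +oo)%E ->
  galton_watson q Z ->
  {ae P, forall w, (Z n w)%:R / mean q ^+ n @[n --> \oo] --> W w} ->
  let mu := mean q in
  let phi := laplace_transform W in
  forall a : R, 0 <= a ->
  (p = 1%N -> halfline_deriven 1 phi a != 0) ->
  forall (n : nat) (L : set T), natural_filtration Z n L ->
  fine 'E_P[fun w => (Hpoly R p).[(Z (m + n)%N w)%:R]
                     * expR (- (a * (Z (m + n)%N w)%:R / mu ^+ (m + n)))
                     * \1_L w]
  / fine 'E_P[fun w => (Hpoly R p).[(Z (m + n)%N w)%:R]
                       * expR (- (a * (Z (m + n)%N w)%:R / mu ^+ (m + n)))]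
    @[m --> \oo] -->
  fine 'E_P[fun w => (mu ^+ (p * n))^-1 * Gfun phi mu a p n (Z n w) * \1_L w].
Proof.
move=> p0 offq mu1 qp [xi [indep law Z0 ZS]] Wlim mu phi a a0 phi1 n L FL.
have q1 := offspring_mean_fin offq.
have mu0 : 0 < mu := lt_trans ltr01 mu1.
pose V w := Num.max (W w) 0.
have mW : measurable_fun setT (W : T -> R) by exact: measurable_funP.
have mV : measurable_fun setT V by exact: measurable_maxr.
have V0 w : 0 <= V w by rewrite le_max lexx orbT.
have WV : {ae P, forall w, W w = V w}.
  apply: filterS Wlim => w Ww; rewrite /V max_l //.
  apply: (ler_cvg_to (cvg_cst 0) Ww); apply: nearW => k.
  by rewrite divr_ge0 // exprn_ge0 // ltW.
have Vlim : {ae P, forall w, normalized q Z k w @[k --> \oo] --> V w}.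
  by apply: filterS2 Wlim WV => w Ww <-.
have phiE : phi = laplace_moment P V setT 0.
  apply/funext => b; rewrite /phi /laplace_transform unlock /laplace_moment.
  rewrite /Rintegral; congr fine; apply: ae_eq_integral => //.
  - apply/measurable_EFinP; apply: measurableT_comp => //.
    by apply: measurableT_comp => //; exact: measurable_funM.
  - by apply/measurable_EFinP; exact: measurable_laplace.
  - by apply: filterS WV => w -> _; rewrite expr0 mul1r.
have nL := natural_filtration_past_event FL.
have mL := measurable_past_event indep law Z0 ZS nL.
have LMT : laplace_moment P V setT p a != 0.
  apply: (limit_moment_neq0 indep law Z0 ZS q1 mu1 mV V0 Vlim p0 qp a0).
  by rewrite -phiE.
rewrite phiE (expectation_Gfun indep law Z0 ZS q1 mu1 mV V0 Vlim p0 qp a0 nL LMT).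
under eq_fun => m.
  rewrite (expectation_Hpoly Z mu1 p a (m + n)%N mL).
  rewrite (expectation_Hpoly_total Z mu1 p a (m + n)%N).
  rewrite -mulf_div divff ?mul1r; last first.
    by rewrite mulf_neq0 ?invr_eq0 ?expf_neq0 ?gt_eqF // ltr0n fact_gt0.
  over.
exact: (cvg_ratio indep law Z0 ZS q1 mu1 mV V0 Vlim p0 qp a0 nL LMT).
Qed.
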